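(* Let $G$ be an affine algebraic group over $\Bbbk$. If $G$ has a periodic connected component, then the identity component $G^0$ is solvable.
   Context: $\Bbbk$ is an algebraically closed field of characteristic zero. A connected component of an affine algebraic group is called periodic if all its elements have finite order. *)

(* Defs.v *)
From HB Require Import structures.
From mathcomp Require Import all_boot all_order all_algebra.
From mathcomp Require Import mpoly.
From mathcomp Require Import boolp classical_sets.
From mathcomp Require Import topology_structure initial_topology connected.

Set Implicit Arguments.
Unset Strict Implicit.
Unset Printing Implicit Defensive.

Import GRing.Theory.

Local Open Scope classical_set_scope.
Local Open Scope ring_scope.

Section ZariskiTopology.
Variables (k : fieldType) (n : nat).

(* An alias of 'rV[k]_n, so that the Zariski topology does not compete with
   the product topology that row vectors inherit from a topological ring. *)
Definition affine_space : Type := 'rV[k]_n.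

HB.instance Definition _ := Choice.on affine_space.

Definition zero_locus (S : set {mpoly k[n]}) : set affine_space :=
  [set v | forall p, S p -> p.@[(v : 'rV[k]_n) 0] = 0].

Definition zariski_open : set (set affine_space) :=
  [set ~` zero_locus S | S in [set: set {mpoly k[n]}]].

Let zariski_openT : zariski_open [set: affine_space].
Proof.
exists [set 1] => //; rewrite -setC0; congr (~` _).
rewrite -subset0 => v /(_ 1 erefl) /eqP.
by rewrite meval1 oner_eq0.
Qed.

Let zariski_openI : setI_closed zariski_open.
Proof.
move=> _ _ [S _ <-] [S' _ <-].
exists [set p * q | p in S & q in S'] => //.
rewrite -setCU; congr (~` _).
apply/seteqP; split => v; last first.
  case=> Sv _ [p Sp [q Sq <-]]; rewrite mevalM.
    by rewrite (Sv p) ?mul0r.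
  by rewrite (Sv q) ?mulr0.
move=> SS'v; apply: contrapT => /not_orP[].
move=> /existsNP[p /not_implyP[Sp pv]] /existsNP[q /not_implyP[Sq qv]].
have /eqP := SS'v (p * q) (ex_intro2 _ _ p Sp (ex_intro2 _ _ q Sq erefl)).
by rewrite mevalM mulf_eq0 => /orP[] /eqP.
Qed.

Let zariski_open_bigU (I : Type) (f : I -> set affine_space) :
  (forall i, zariski_open (f i)) -> zariski_open (\bigcup_i f i).
Proof.
move=> fopen; pose S i := projT1 (cid2 (fopen i)).
have fE i : f i = ~` zero_locus (S i) by rewrite /S; case: cid2.
exists (\bigcup_i S i) => //.
rewrite (eq_bigcupr (fun i _ => fE i)) -setC_bigcap; congr (~` _).
apply/seteqP; split=> v Sv.
  by move=> i _ p Sip; apply: Sv; exists i.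
by move=> p [i _ Sip]; apply: (Sv i).
Qed.

HB.instance Definition _ := isOpenTopological.Build affine_space
  zariski_openT zariski_openI zariski_open_bigU.

Lemma zariski_closedP (Z : set affine_space) :
  closed Z <-> exists S, Z = zero_locus S.
Proof.
rewrite -openC; split=> [[S _ SZ]|[S ->]]; last by exists S.
by exists S; apply: setC_inj.
Qed.

End ZariskiTopology.

(* The variety underlying the group is presented by a closed embedding
   of its points into some affine space.  Morphisms of affine varieties are
   then the maps given by polynomials in the coordinates, the product of the
   variety with itself being embedded in the affine space of dimension
   ambient_dim + ambient_dim. *)
Record affine_algebraic_group (k : closedFieldType) := AffineAlgebraicGroup {
  points :> groupType;
  ambient_dim : nat;
  embedding : points -> affine_space k ambient_dim;
  embedding_inj : injective embedding;
  embedding_closed : closed (range embedding);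
  mul_morphism : exists P : 'I_ambient_dim -> {mpoly k[ambient_dim + ambient_dim]},
    forall (x y : points) (i : 'I_ambient_dim),
      (embedding (x * y)%g : 'rV[k]_ambient_dim) 0 i
        = (P i).@[(row_mx (embedding x) (embedding y) : 'rV[k]_(_ + _)) 0];
  inv_morphism : exists P : 'I_ambient_dim -> {mpoly k[ambient_dim]},
    forall (x : points) (i : 'I_ambient_dim),
      (embedding x^-1%g : 'rV[k]_ambient_dim) 0 i
        = (P i).@[(embedding x : 'rV[k]_ambient_dim) 0]
}.

Section ConnectedComponents.
Variables (k : closedFieldType) (G : affine_algebraic_group k).

Definition component (x : G) : set G :=
  @connected_component (initial_topology (@embedding k G)) [set: G] x.

Definition is_component (C : set G) : Prop := exists x : G, C = component x.

Definition identity_component : set G := component 1%g.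

End ConnectedComponents.

Arguments identity_component {k} G.

Section AbstractGroups.
Variable gT : groupType.
Local Open Scope group_scope.

Definition finite_order (x : gT) : Prop := exists2 n : nat, (0 < n)%N & x ^+ n = 1.

Definition periodic (A : set gT) : Prop := forall x, A x -> finite_order x.

Definition is_subgroup (H : set gT) : Prop :=
  [/\ H 1, forall x y, H x -> H y -> H (x * y) & forall x, H x -> H x^-1].

Definition derived_subgroup (H : set gT) : set gT :=
  smallest is_subgroup [set [~ x, y] | x in H & y in H].

Definition is_solvable (H : set gT) : Prop :=
  exists n, iter n derived_subgroup H = [set 1].

End AbstractGroups.

(* Main.v *)
Require Import Defs.
From HB Require Import structures.
From mathcomp Require Import all_boot all_order all_algebra.
From mathcomp Require Import cyclic separable cyclotomic closed_field.
From mathcomp Require Import mpoly zify ring.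
From mathcomp Require Import boolp classical_sets.
From mathcomp Require Import topology_structure initial_topology connected.
From mathcomp Require Import subspace_topology.

(* Write H for the identity component and gH for the periodic component, and
   embed G into GL_N. The traces of the elements of gH are sums of roots of
   unity, hence integral over Z. A regular function takes finitely many or
   cofinitely many values, and cofinitely many values cannot all be integral, so
   these traces are constant on the connected set gH. Hence all elements of gH
   satisfy x^m = 1 for a common m, and differentiating (g h)^m = 1 at h = 1 shows
   that Ad g has no nonzero fixed vector on the Lie algebra of H. By Kreknin's
   theorem on Z/m-graded Lie rings with zero component in degree 0, this Lie
   algebra is solvable. On an irreducible representation of H the terms of its
   derived series act by scalars, from the last one upwards: commutators that
   are scalar have trace 0, so they vanish, and a commuting set normalized by H
   is scalar because H, being connected, fixes its weights. In characteristic 0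
   a regular function on H killed by all derivations is constant, so H acts on
   the irreducible representation through a commutative group, and the action of
   H on any representation is solvable by induction on the dimension. *)

Set Implicit Arguments.
Unset Strict Implicit.
Unset Printing Implicit Defensive.

Import Order.TTheory GRing.Theory.
Local Open Scope classical_set_scope.
Local Open Scope ring_scope.

(** * Noetherianity of polynomial rings *)

(** Two obstacles shape the proof. First, Ad g has an arbitrary finite order, so nilpotency theorems
    for prime order do not apply; Kreknin's theorem gives solvability for every order, once
    conjugation by g is diagonalized with a primitive root of unity. Second, the Lie algebra has to
    control the group, and no correspondence between subgroups and subalgebras is set up: the only
    bridge is that vanishing derivatives force constancy. This is obtained without irreducibility or
    smoothness of H: all powers of the maximal ideal at a point contain the deviation of the
    function from its value there, Krull's intersection theorem makes the function constant near the
    point, and connectedness spreads this over H. Solvability of the Lie algebra is found in a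
    faithful representation of G but used in subquotients on which only H need act; hence
    derivations are functionals on functions, independent of any representation. Noetherianity
    enters twice: in Krull's theorem, and in replacing the equations of H by finitely many, as
    quantifier elimination requires. *)

Lemma nondecreasing_subsequence (u : nat -> nat) :
  exists2 s : nat -> nat, {homo s : i j / (i < j)%N} &
    {homo u \o s : i j / (i <= j)%N}.
Proof.
(* Every tail has a smallest term; [s] jumps from the position of one such minimum to that of the
   next tail, so the values never decrease. *)
have min_tail N : exists i, (N <= i)%N /\ forall j, (N <= j)%N -> (u i <= u j)%N.
  suff H v : forall i, (N <= i)%N -> (u i <= v)%N ->
      exists i, (N <= i)%N /\ forall j, (N <= j)%N -> (u i <= u j)%N.
    exact: (H (u N) N).
  elim: v => [|v IHv] i Ni uv.
    by exists i; split=> // j _; rewrite (leq_trans uv).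
  have [[j [Nj ujv]]|no_smaller] := pselect (exists j, (N <= j)%N /\ (u j <= v)%N).
    exact: IHv ujv.
  exists i; split=> // j Nj; apply: (leq_trans uv).
  by rewrite ltnNge; apply/negP => ujv; apply: no_smaller; exists j.
have [a aP] := choice min_tail.
pose s := fix s i := if i is j.+1 then a (s j).+1 else a 0%N.
exists s.
  by apply: homo_ltn; [exact: ltn_trans | move=> i; case: (aP (s i).+1)].
apply: homo_leq; [exact: leqnn | exact: leq_trans |] => -[|i] /=.
  by apply: (aP 0%N).2.
apply: (aP (s i).+1).2; rewrite -/s.
by apply: ltnW; apply: (leq_ltn_trans (aP (s i).+1).1); case: (aP (a (s i).+1).+1).
Qed.

(** Extracting a subsequence once per coordinate makes all exponents nondecreasing along it; its
    first two terms then serve. *)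
Lemma dickson n (m : nat -> 'X_{1..n}) :
  exists i j, (i < j)%N /\ (m i <= m j)%MM.
Proof.
suff [s s_incr sP] : exists2 s : nat -> nat, {homo s : i j / (i < j)%N} &
    forall l, l \in enum 'I_n -> {homo (fun i => m (s i) l) : i j / (i <= j)%N}.
  exists (s 0%N), (s 1%N); split; first exact: s_incr.
  by apply/mnm_lepP => l; apply: (sP l); rewrite ?mem_enum.
elim: (enum 'I_n) => [|l r [s s_incr sP]]; first by exists id.
have [t t_incr tP] := nondecreasing_subsequence (fun i => m (s i) l).
exists (s \o t) => [i j ij|l']; first by apply/s_incr/t_incr.
rewrite inE => /orP[/eqP -> //|l'r] i j ij /=.
apply: (sP l' l'r); move: ij; rewrite leq_eqVlt => /predU1P[-> //|/t_incr].
exact: ltnW.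
Qed.

Section Ideals.
Variable R : comNzRingType.

Definition ideal (J : set R) :=
  [/\ J 0, forall x y, J x -> J y -> J (x + y) & forall a x, J x -> J (a * x)].

Definition combination (p : nat -> R) j : set R :=
  [set x | exists c : nat -> R, x = \sum_(i < j) c i * p i].

Lemma ideal_combination p j : ideal (combination p j).
Proof.
split=> [|x y [c ->] [d ->]|a x [c ->]].
- by exists (fun=> 0); rewrite big1 // => i _; rewrite mul0r.
- exists (fun i => c i + d i); rewrite -big_split; apply: eq_bigr => i _.
  by rewrite mulrDl.
- exists (fun i => a * c i); rewrite mulr_sumr; apply: eq_bigr => i _.
  by rewrite mulrA.
Qed.

Lemma ideal_sum J (I : Type) (r : seq I) (P : pred I) (F : I -> R) : ideal J ->
  (forall i, P i -> J (F i)) -> J (\sum_(i <- r | P i) F i).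
Proof. by case=> J0 JD _ JF; apply: big_ind. Qed.

Lemma idealB J x y : ideal J -> J x -> J y -> J (x - y).
Proof.
by case=> _ JD JM Jx Jy; apply: JD => //; rewrite -mulN1r; apply: JM.
Qed.

Lemma combination_gen p i j : (i < j)%N -> combination p j (p i).
Proof.
move=> ij; exists (fun l => if l == i then 1 else 0).
rewrite (bigD1 (Ordinal ij)) //= eqxx mul1r big1 ?addr0 // => l /negPf li.
by rewrite -[l == i :> nat]/(l == Ordinal ij) li mul0r.
Qed.

Lemma combination_sub p j J : ideal J -> (forall i, (i < j)%N -> J (p i)) ->
  (combination p j `<=` J)%classic.
Proof.
move=> Ji Jp x [c ->]; apply: ideal_sum => // i _.
by case: Ji => _ _; apply; apply: Jp.
Qed.

(** The ascending chain condition stated for sequences of elements, the form in which Dickson's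
    lemma delivers it and sequences built by choice contradict it. *)
Definition noetherian := forall p : nat -> R, exists j, combination p j (p j).

(** Without a maximal member, choice yields an ascending chain in [F] with an element new at each
    stage; by noetherianity one of these would be a combination of earlier ones, hence not new. *)
Lemma noetherian_max (F : set (set R)) : noetherian ->
  (F `<=` ideal)%classic -> (exists J, F J) ->
  exists2 M, F M & forall J, F J -> (M `<=` J)%classic -> J = M.
Proof.
move=> noeth Fideal [J0 FJ0]; apply: contrapT => nomax.
have step (J : {J : set R | F J}) :
    exists y : {J : set R | F J} * R, (sval J `<=` sval y.1)%classic /\
      sval y.1 y.2 /\ ~ sval J y.2.
  apply: contrapT => stuck; apply: nomax; exists (sval J); first exact: (svalP J).
  move=> J' FJ' JJ'; apply/seteqP; split=> // x J'x; apply: contrapT => Jx.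
  by apply: stuck; exists (exist _ J' FJ', x).
have [next nextP] := choice step.
pose Js := fix Js i := if i is j.+1 then (next (Js j)).1 else exist _ J0 FJ0.
have Js_incr i j : (i <= j)%N -> (sval (Js i) `<=` sval (Js j))%classic.
  apply: (@homo_leq _ (fun i => sval (Js i)) (fun A B => A `<=` B)%classic).
  - exact: subset_refl.
  - exact: subset_trans.
  - by move=> l; case: (nextP (Js l)).
have [j] := noeth (fun i => (next (Js i)).2).
suff sub : (combination (fun i => (next (Js i)).2) j `<=` sval (Js j))%classic.
  by move=> /sub; case: (nextP (Js j)) => _ [].
apply: combination_sub => [|i ij]; first by apply: Fideal; case: (Js j).
by apply: (Js_incr _ _ ij); case: (nextP (Js i)) => _ [].
Qed.

(* The hypothesis says that f lies in I + (t)^s for all s. Otherwise take Q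
   maximal among the ideals that contain I + (t) f but not f. Noetherianity
   stabilizes (Q : t_i^s), so maximality of Q forces some power of each t_i into
   Q, hence f into Q. *)
Lemma krull_intersection (d : nat) (t : 'I_d -> R) (I : set R) (f : R) :
  noetherian -> ideal I ->
  (forall Q, ideal Q -> (I `<=` Q)%classic ->
     (exists s, forall i, Q (t i ^+ s)) -> Q f) ->
  exists b : 'I_d -> R, I (f - (\sum_i b i * t i) * f).
Proof.
move=> noeth Ii fQ.
pose K : set R := [set x : R | exists b : 'I_d -> R, I (x - (\sum_i b i * t i) * f)].
suff: K f by [].
have Ki : ideal K.
  case: (Ii) => I0 ID IM; split=> [|x y [b Ix] [c Iy]|a x [b Ix]].
  - exists (fun=> 0); rewrite big1 ?mul0r ?subr0 // => i _; exact: mul0r.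
  - exists (fun i => b i + c i).
    under eq_bigr do rewrite mulrDl.
    by rewrite big_split mulrDl opprD addrACA; apply: ID.
  - exists (fun i => a * b i).
    under eq_bigr do rewrite -mulrA.
    by rewrite -mulr_sumr -mulrA -mulrBr; apply: IM.
apply: contrapT => Kf.
have [Q [Qi KQ Qf] Qmax] := @noetherian_max
   [set Q | [/\ ideal Q, K `<=` Q & ~ Q f]%classic] noeth
   (fun _ '(And3 h _ _) => h)
   (ex_intro _ K (And3 Ki (@subset_refl _ K) Kf)).
case: (Qi) => Q0 QD QM; apply: (Qf); apply: fQ => // [x Ix|].
  apply: KQ; exists (fun=> 0); rewrite big1 ?mul0r ?subr0 // => i _; exact: mul0r.
have tfQ i : Q (t i * f).
  apply: KQ; exists (fun j => if j == i then 1 else 0).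
  rewrite (bigD1 i) //= eqxx mul1r big1 ?addr0 ?subrr; first by case: Ii.
  by move=> j /negPf ->; rewrite mul0r.
suff tQ i : exists s, Q (t i ^+ s).
  have [s sP] := choice tQ.
  exists (\sum_i s i)%N => i.
  by rewrite (bigD1 i) //= addnC exprD; apply: QM.
pose colon s : set R := [set r : R | Q (r * t i ^+ s)].
have colon_ideal s : ideal (colon s).
  split=> [|x y|a x]; rewrite /colon /= ?mul0r // ?mulrDl; first exact: QD.
  by rewrite -mulrA; apply: QM.
have [_ [s _ <-] smax] := @noetherian_max (range colon) noeth
  (fun _ '(ex_intro2 s _ e) => eq_rect _ ideal (colon_ideal s) _ e)
  (ex_intro _ (colon 0%N) (imageT colon 0%N)).
have colonS : colon s.+1 = colon s.
  apply: smax; first by exists s.+1.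
  by move=> r; rewrite /colon /= exprS mulrCA; apply: QM.
exists s; apply: contrapT => tsQ.
(* If [t i ^+ s] is not in [Q], then [Q'] is strictly larger and contains f. Multiplying f = q + r
   t_i^s by t_i puts r t_i^(s+1) in [Q]; the stable colon ideal gives r t_i^s in [Q], hence f in
   [Q]. *)
pose Q' : set R := [set x : R | exists q r, Q q /\ x = q + r * t i ^+ s].
have Q'Q : Q' = Q.
  apply: Qmax; last first.
    by move=> x Qx; exists x, 0; rewrite mul0r addr0.
  split.
  - split=> [|x y [q [r [Qq ->]]] [q' [r' [Qq' ->]]]|a x [q [r [Qq ->]]]].
    + by exists 0, 0; rewrite mul0r addr0.
    + by exists (q + q'), (r + r'); rewrite mulrDl addrACA; split; first exact: QD.
    + by exists (a * q), (a * r); rewrite mulrDr mulrA; split; first exact: QM.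
  - by move=> x /KQ Qx; exists x, 0; rewrite mul0r addr0.
  - move=> [q [r [Qq fE]]]; apply: Qf.
    suff: colon s.+1 r.
      by rewrite colonS /colon /= => Qr; rewrite fE; apply: QD.
    rewrite /colon /= exprS mulrCA.
    have -> : t i * (r * t i ^+ s) = t i * f - t i * q.
      by rewrite fE mulrDr addrAC subrr add0r.
    by apply: idealB => //; apply: QM.
by apply: tsQ; rewrite -Q'Q; exists 0, 1; rewrite add0r mul1r.
Qed.

End Ideals.

(* Dickson's lemma applied to the leading monomials of the p_j reduced modulo
   the ideal of their predecessors. *)
Theorem hilbert_basis (k : fieldType) n : noetherian {mpoly k[n]}.
Proof.
move=> p; apply: contrapT => notin.
have {}notin j : ~ combination p j (p j) by move=> h; apply: notin; exists j.
have red j : exists q, combination p j (p j - q) /\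
    forall q', combination p j (p j - q') -> ~~ (mlead q' < mlead q)%O.
  pose P m := exists2 q, combination p j (p j - q) & mlead q = m.
  have: exists m, P m.
    exists (mlead (p j)); exists (p j) => //; rewrite subrr.
    by case: (ideal_combination p j).
  case=> m; elim/(well_founded_ind (@ltom_wf n)): m => m IHm [q qI qm].
  have [[q' q'I q'q]|nolt] := pselect (exists2 q', combination p j (p j - q') &
       (mlead q' < mlead q)%O).
    by apply: (IHm (mlead q')); [rewrite -qm | exists q'].
  by exists q; split=> // q' q'I; apply/negP => q'q; apply: nolt; exists q'.
have [q qP] := choice red.
have [i [j [ij leij]]] := dickson (fun j => mlead (q j)).
have q_neq0 l : q l != 0.
  by apply/eqP => ql0; apply: (notin l); case: (qP l); rewrite ql0 subr0.
have q_i : combination p j (q i).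
  have -> : q i = p i - (p i - q i) by rewrite opprB addrC subrK.
  apply: idealB; [exact: ideal_combination | exact: combination_gen |].
  case: (qP i) => + _; apply: combination_sub => [|l li].
    exact: ideal_combination.
  by apply: combination_gen; apply: ltn_trans ij.
(* Subtracting a multiple of [q i] cancels the leading term of [q j] within its residue class,
   against the minimality of its leading monomial. *)
pose m := (mlead (q j) - mlead (q i))%MM.
pose c := mleadc (q j) / mleadc (q i).
pose r := q j - (c *: 'X_[m]) * q i.
have rI : combination p j (p j - r).
  rewrite /r opprB addrCA addrC; case: (ideal_combination p j) => _ ID IM.
  by apply: ID; [case: (qP j) | apply: IM].
have rq : (mlead ((c *: 'X_[m]) * q i) = mlead (q j)).
  rewrite -scalerAl mleadZ; last first.
    by rewrite mulf_neq0 ?invr_eq0 ?mleadc_eq0.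
  have X0 : 'X_[m] != 0 :> {mpoly k[n]} by rewrite -mleadc_eq0 mleadXm mcoeffX eqxx oner_neq0.
  by rewrite mleadM ?q_neq0 // mleadXm /m submK.
have r0 : r != 0.
  by apply/eqP => r0; apply: (notin j); move: rI; rewrite r0 subr0.
have [_ /(_ r rI)/negP] := qP j; apply.
rewrite lt_neqAle; apply/andP; split; last first.
  by apply: (le_trans (mleadB_le _ _)); rewrite rq joinxx.
apply: contra_neq r0 => rlead; apply/eqP; rewrite -mleadc_eq0 rlead.
have mE : (mlead 'X_[k, m] + mlead (q i))%MM = mlead (q j) by rewrite mleadXm submK.
rewrite /r mcoeffB -scalerAl mcoeffZ -{2}mE mleadcM mleadXm mcoeffX eqxx mul1r.
by rewrite /c divfK ?subrr ?mleadc_eq0.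
Qed.

(** * Images of polynomial maps and traces of matrices of finite order *)

Lemma mpoly_ring_ind (R : comNzRingType) n (P : {mpoly R[n]} -> Prop) :
  (forall c, P c%:MP) -> (forall i, P 'X_i) ->
  (forall p q, P p -> P q -> P (p + q)) ->
  (forall p q, P p -> P q -> P (p * q)) -> forall p, P p.
Proof.
move=> PC PX PD PM; elim/mpolyind => [|c m p _ _ Pp]; first by rewrite -mpolyC0.
apply: PD => //; rewrite -mul_mpolyC; apply: (PM) => //.
have P1 : P 1 by rewrite -mpolyC1.
rewrite mpolyXE_id; apply: big_ind => // i _; elim: (m i) => [|j IHj].
  by rewrite expr0.
by rewrite exprS; apply: PM.
Qed.

Section Image.
Variable k : closedFieldType.

(** Variable 0 is reserved for the value of the polynomial map, hence the shift of the coordinates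
    by one. *)
Lemma mpoly_term n (p : {mpoly k[n]}) : exists2 t : GRing.term k, GRing.rterm t &
  forall (c : k) (e : n.-tuple k), GRing.eval (c :: e) t = p.@[tnth e].
Proof.
elim/mpoly_ring_ind: p => [c|i|p q [s rs sE] [t rt tE]|p q [s rs sE] [t rt tE]].
- by exists (GRing.Const c) => //= ? e; rewrite mevalC.
- by exists (GRing.Var k i.+1) => //= c e; rewrite mevalXU (tnth_nth 0).
- by exists (s + t)%T => [|c e] /=; rewrite ?rs // mevalD sE tE.
- by exists (s * t)%T => [|c e] /=; rewrite ?rs // mevalM sE tE.
Qed.

Lemma holds_exists n s (f : GRing.formula k) :
  GRing.holds s (foldr (@GRing.Exists k) f (iota (size s) n)) <->
  exists e : n.-tuple k, GRing.holds (s ++ e) f.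
Proof.
elim: n s => [|n IHn] s /=.
  split=> [sf|[e]]; last by rewrite tuple0 cats0.
  by exists [tuple]; rewrite cats0.
split=> [[x]|[e]].
  rewrite -[(size s).+1](size_rcons s x).
  have -> : set_nth 0 s (size s) x = rcons s x by elim: (s) => //= ? ? ->.
  move=> /IHn[e ef]; exists [tuple of x :: e].
  by rewrite cat_rcons in ef.
case/tupleP: e => x e ef; exists x.
have -> : set_nth 0 s (size s) x = rcons s x by elim: (s) => //= ? ? ->.
rewrite -[(size s).+1](size_rcons s x); apply/IHn.
by exists e; rewrite cat_rcons.
Qed.

(** An equation between polynomials in c holds at finitely many c or at all of them, and Boolean
    operations preserve being finite or cofinite. The roots of [Q] need only contain the finite set,
    so products of such polynomials handle the connectives. *)
Lemma qf_finite_or_cofinite (f : GRing.formula k) :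
  GRing.qf_form f -> GRing.rformula f -> exists2 Q : {poly k}, Q != 0 &
  (forall c, GRing.qf_eval [:: c] f -> root Q c) \/
  (forall c, ~~ GRing.qf_eval [:: c] f -> root Q c).
Proof.
have polyt t : GRing.rterm t ->
    exists P : {poly k}, forall c, GRing.eval [:: c] t = P.[c].
  elim: t => //=.
  - move=> [|i] _; first by exists 'X => c; rewrite hornerX.
    (* Variables beyond the one-element environment evaluate to the default 0. *)
    by exists 0 => c; rewrite horner0 nth_default.
  - by move=> x _; exists x%:P => c; rewrite hornerC.
  - by move=> x _; exists x%:R => c; rewrite hornerMn hornerC.
  - move=> s IHs t IHt /andP[/IHs[P PE] /IHt[P' P'E]].
    by exists (P + P') => c; rewrite hornerD PE P'E.
  - by move=> s IHs /IHs[P PE]; exists (- P) => c; rewrite hornerN PE.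
  - by move=> s IHs i /IHs[P PE]; exists (P *+ i) => c; rewrite hornerMn PE.
  - move=> s IHs t IHt /andP[/IHs[P PE] /IHt[P' P'E]].
    by exists (P * P') => c; rewrite hornerM PE P'E.
  - by move=> s IHs i /IHs[P PE]; exists (P ^+ i) => c; rewrite horner_exp PE.
have M (P P' : {poly k}) : P != 0 -> P' != 0 -> P * P' != 0 by exact: mulf_neq0.
elim: f => //=.
- move=> b _ _; exists 1; first exact: oner_neq0.
  by case: b; [right|left].
- move=> s t _ /andP[/polyt[P PE] /polyt[P' P'E]].
  have [PP'|PP'] := eqVneq P P'.
    exists 1; first exact: oner_neq0.
    by right=> c; rewrite PE P'E PP' eqxx.
  exists (P - P'); first by rewrite subr_eq0.
  by left=> c; rewrite PE P'E rootE hornerD hornerN subr_eq0.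
- move=> f IHf g IHg /andP[/IHf{}IHf /IHg{}IHg] /andP[/IHf[Q Q0 Qf] /IHg[Q' Q'0 Q'g]].
  exists (Q * Q'); first exact: M.
  case: Qf => Qf; first by left=> c /andP[/Qf Qc _]; rewrite rootM Qc.
  case: Q'g => Q'g; first by left=> c /andP[_ /Q'g Qc]; rewrite rootM Qc orbT.
  by right=> c; rewrite negb_and rootM => /orP[/Qf|/Q'g] ->; rewrite ?orbT.
- move=> f IHf g IHg /andP[/IHf{}IHf /IHg{}IHg] /andP[/IHf[Q Q0 Qf] /IHg[Q' Q'0 Q'g]].
  exists (Q * Q'); first exact: M.
  case: Qf => Qf; last first.
    by right=> c; rewrite negb_or => /andP[/Qf Qc _]; rewrite rootM Qc.
  case: Q'g => Q'g; last first.
    by right=> c; rewrite negb_or => /andP[_ /Q'g Qc]; rewrite rootM Qc orbT.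
  by left=> c; rewrite rootM => /orP[/Qf|/Q'g] ->; rewrite ?orbT.
- move=> f IHf g IHg /andP[/IHf{}IHf /IHg{}IHg] /andP[/IHf[Q Q0 Qf] /IHg[Q' Q'0 Q'g]].
  exists (Q * Q'); first exact: M.
  case: Qf => Qf.
    by right=> c; rewrite negb_imply => /andP[/Qf Qc _]; rewrite rootM Qc.
  case: Q'g => Q'g; last first.
    by right=> c; rewrite negb_imply => /andP[_ /Q'g Qc]; rewrite rootM Qc orbT.
  by left=> c; rewrite implybE rootM => /orP[/Qf|/Q'g] ->; rewrite ?orbT.
- move=> f IHf qf rf; have [Q Q0 Qf] := IHf qf rf; exists Q => //.
  by case: Qf => Qf; [right|left] => c; rewrite ?negbK; apply: Qf.
Qed.

(** A case of Chevalley's theorem: the image is described by an existential formula in c, and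
    quantifier elimination over a closed field makes it quantifier-free. *)
Lemma image_finite_or_cofinite n (ps : seq {mpoly k[n]}) (p : {mpoly k[n]}) :
  exists2 Q : {poly k}, Q != 0 &
  (forall e : n.-tuple k, (forall q, q \in ps -> q.@[tnth e] = 0) ->
     root Q p.@[tnth e]) \/
  (forall c, ~~ root Q c -> exists2 e : n.-tuple k,
     (forall q, q \in ps -> q.@[tnth e] = 0) & p.@[tnth e] = c).
Proof.
have [t rt tE] := mpoly_term p.
have [f rf fP] : exists2 f : GRing.formula k, GRing.rformula f &
    forall c (e : n.-tuple k), GRing.holds (c :: e) f <->
      ((forall q, q \in ps -> q.@[tnth e] = 0) /\ p.@[tnth e] = c).
  elim: ps => [|q ps [f rf fP]].
    exists (GRing.Equal t (GRing.Var k 0)) => /=; first by rewrite rt.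
    by move=> c e; rewrite tE; split=> [->|[]].
  have [s rs sE] := mpoly_term q.
  exists (GRing.And f (GRing.Equal s (GRing.Const 0))) => [|c e] /=.
    by rewrite rf rs.
  rewrite sE; split=> [[/fP[psE pE] qE]|[psE pE]].
    by split=> // r; rewrite inE => /orP[/eqP ->|/psE].
  split; last by apply: psE; rewrite mem_head.
  by apply/fP; split=> // r r_ps; apply: psE; rewrite inE r_ps orbT.
pose g := foldr (@GRing.Exists k) f (iota 1 n).
have rg : GRing.rformula g by rewrite /g; elim: (iota 1 n).
pose qe := GRing.quantifier_elim (@ClosedFieldQE.ex_elim k).
have gP c : reflect (GRing.holds [:: c] g) (GRing.qf_eval [:: c] (qe g)).
  apply: GRing.quantifier_elim_rformP => //.
    exact: ClosedFieldQE.wf_ex_elim.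
  exact/ClosedFieldQE.holds_ex_elim/solve_monicpoly.
have /andP[qfg rqg] := GRing.quantifier_elim_wf (@ClosedFieldQE.wf_ex_elim k) rg.
have [Q Q0 QP] := qf_finite_or_cofinite qfg rqg.
exists Q => //; case: QP => QP; [left=> e eps|right=> c Qc].
  by apply/QP/gP/(holds_exists n [:: _]); exists e; apply/fP.
have /gP/(holds_exists n [:: c])[e /fP[eps pe]] : GRing.qf_eval [:: c] (qe g).
  by apply: contraNT Qc; apply: QP.
by exists e.
Qed.

End Image.

(** * Traces of matrices of finite order *)

Section Traces.
Variables (k : closedFieldType) (pchar_k : [pchar k] =i pred0).

Lemma natf_eq0 n : (n%:R == 0 :> k) = (n == 0)%N.
Proof. by move/pcharf0P: pchar_k. Qed.

Lemma intf_eq0 (z : int) : (z%:~R == 0 :> k) = (z == 0).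
Proof.
case: z => n; first exact: natf_eq0.
by rewrite NegzE rmorphN !oppr_eq0; apply: (natf_eq0 n.+1).
Qed.

(** Multiplying a monic integral relation of degree d for 1/2 by 2^d gives 1 + 2z = 0 with z an
    integer, which parity excludes since the integers embed in [k]. *)
Lemma half_not_integral : ~ integralOver (intr : int -> k) 2^-1.
Proof.
case=> p p_monic /rootP p0.
have two0 : 2 != 0 :> k by rewrite natf_eq0.
pose d := (size p).-1.
have sp : size p = d.+1 by rewrite prednK // size_poly_gt0 monic_neq0.
pose z := \sum_(i < d) p`_i * 2 ^+ (d.-1 - i).
suff: (1 + 2 * z)%:~R == 0 :> k.
  by rewrite intf_eq0; lia.
apply/eqP; rewrite -(mulr0 (2 ^+ d)) -p0 horner_coef size_map_poly_id0 ?sp; last first.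
  by rewrite (monicP p_monic) rmorph1 oner_neq0.
rewrite big_ord_recr /= !coef_map /=.
have -> : p`_d = 1 by rewrite -(monicP p_monic) lead_coefE sp.
rewrite rmorph1 mul1r mulrDr -exprMn divff // expr1n addrC rmorphD rmorph1.
congr (_ + _); rewrite rmorphM rmorph_sum !mulr_sumr.
apply: eq_bigr => i _; rewrite coef_map /= rmorphM rmorphXn /=.
rewrite mulrCA [2 ^+ d * _]mulrCA; congr (_ * _).
have id : (i < d)%N by [].
rewrite -exprS -subSn; last by rewrite -ltnS prednK // (leq_ltn_trans _ id).
rewrite prednK ?(leq_ltn_trans _ id) // exprVn.
have -> : 2 ^+ d = 2 ^+ (d - i) * 2 ^+ i :> k by rewrite -exprD subnK // ltnW.
by rewrite mulfK // expf_neq0.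
Qed.

Lemma trace_integral N n (y : 'M[k]_N) : (0 < n)%N -> y ^+ n = 1 ->
  integralOver (intr : int -> k) (\tr y).
Proof.
move=> n0 yn.
have [r rE] := closed_field_poly_normal (char_poly y).
rewrite (monicP (char_poly_monic y)) scale1r in rE.
have sr : size r = N.
  by apply: succn_inj; rewrite -(size_prod_XsubC r id) -rE size_char_poly.
have r_integral z : z \in r -> integralOver (intr : int -> k) z.
  rewrite -root_prod_XsubC -rE -eigenvalue_root_char => /eigenvalueP[v vy v0].
  have zn : z ^+ n = 1.
    have vyn i : v *m y ^+ i = z ^+ i *: v.
      elim: i => [|i IHi]; first by rewrite !expr0 mulmx1 scale1r.
      by rewrite exprSr -mulmxE mulmxA IHi -scalemxAl vy scalerA exprSr.
    have /eqP := vyn n; rewrite yn mulmx1 -subr_eq0 -{1}[v]scale1r -scalerBl.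
    by rewrite scaler_eq0 (negPf v0) orbF subr_eq0 => /eqP <-.
  exists ('X^n - 1); first exact: monicXnsubC.
  by rewrite rmorphB /= map_polyXn rmorph1 rootE !hornerE zn subrr.
(* The trace is read off the coefficient of degree N - 1, so N = 0 is set apart. *)
case: N y yn rE sr => [|N] y yn rE sr.
  by rewrite [y]flatmx0 mxtrace0 -(rmorph0 intr); apply: integral_id.
have -> : \tr y = \sum_(z <- r) z.
  apply: oppr_inj; rewrite -char_poly_trace // rE.
  by rewrite -[N.+1.-1]/(N.+1.-1) -sr coefPn_prod_XsubC ?sr.
rewrite big_seq; apply: big_ind => // [|u v].
  by rewrite -(rmorph0 intr); apply: integral_id.
exact: integral_add.
Qed.

(** Factor [P] through its image: the factors multiply to [P] in one order and, by idempotence, to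
    an identity matrix in the other, with the same trace. *)
Lemma trace_idempotent N (P : 'M[k]_N) : P *m P = P -> \tr P = (\rank P)%:R.
Proof.
move=> PP; rewrite -{1}(mulmx_base P) mxtrace_mulC.
suff -> : row_base P *m col_base P = 1%:M by rewrite mxtrace1.
have: col_base P *m (row_base P *m col_base P) *m row_base P =
      col_base P *m 1%:M *m row_base P.
  by rewrite mulmx1 -mulmxA -mulmxA mulmxA !mulmx_base PP.
move/(row_free_inj (row_base_free P)).
have /row_fullP[B BC] := col_base_full P.
by move/(congr1 (mulmx B)); rewrite mulmxA BC mul1mx => ->; rewrite mulmxA BC mul1mx.
Qed.

(** The average [P] of the powers of [z] projects onto the vectors fixed by [z]. Its trace, hence in
    characteristic 0 its rank, is N, so P = 1, and z P = P gives z = 1. *)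
Lemma finite_order_trace N n (z : 'M[k]_N) : (0 < n)%N -> z ^+ n = 1 ->
  (forall j, \tr (z ^+ j) = N%:R) -> z = 1.
Proof.
move=> n0 zn trz.
have nk0 : n%:R != 0 :> k by rewrite natf_eq0 -lt0n.
pose S := \sum_(j < n) z ^+ j.
have zS : z * S = S.
  rewrite /S mulr_sumr; move: n0 zn; case: (n) => // l _ zl.
  rewrite big_ord_recr [RHS]big_ord_recl /= -exprS zl expr0 addrC.
  by congr (_ + _); apply: eq_bigr => i _; rewrite -exprS.
have zjS j : z ^+ j * S = S.
  by elim: j => [|j IHj]; rewrite ?expr0 ?mul1r // exprS -mulrA IHj.
pose P := n%:R^-1 *: S.
have zP : z * P = P by rewrite -mulmxE -scalemxAr mulmxE zS.
have PP : P *m P = P.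
  rewrite /P -scalemxAl -scalemxAr mulmxE mulr_suml.
  rewrite (eq_bigr (fun=> S)) => [|j _]; last exact: zjS.
  by rewrite sumr_const card_ord -scaler_nat !scalerA -mulrA mulVf // mulr1.
have trP : \tr P = N%:R.
  rewrite mxtraceZ raddf_sum /= (eq_bigr (fun=> N%:R)) => [|j _]; last exact: trz.
  rewrite sumr_const card_ord; apply: (mulfI nk0); rewrite mulrA mulfV // mul1r.
  by rewrite mulr_natl.
have P_unit : P \in unitmx.
  rewrite -row_full_unit /row_full eqn_leq rank_leq_row /= -subn_eq0.
  by rewrite -natf_eq0 natrB ?rank_leq_row // -trace_idempotent // trP subrr.
have P1 : P = 1 by rewrite -(mulKmx P_unit P) PP mulVmx.
by rewrite -[z]mulr1 -P1.
Qed.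
End Traces.

(** * Kreknin's theorem *)

Section LieBracket.
Variable R : pzRingType.
Implicit Types (x y z : R) (L : set R).

Definition lie x y := x * y - y * x.

(* Only the brackets, not their span: enough to express solvability, since the
   bracket is bilinear. *)
Definition lie_brackets L : set R := [set lie x y | x in L & y in L].

Lemma lie0r x : lie x 0 = 0.
Proof. by rewrite /lie mulr0 mul0r subrr. Qed.
Lemma lie0l x : lie 0 x = 0.
Proof. by rewrite /lie mulr0 mul0r subrr. Qed.
Lemma lieBr x y z : lie x (y - z) = lie x y - lie x z.
Proof. rewrite /lie mulrBr mulrBl !opprB [z * x - _]addrC addrACA.
by rewrite [- (x * z) + _]addrC. Qed.
Lemma lieDr x y z : lie x (y + z) = lie x y + lie x z.
Proof. by rewrite /lie mulrDr mulrDl opprD addrACA. Qed.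
Lemma lieDl x y z : lie (x + y) z = lie x z + lie y z.
Proof. by rewrite /lie mulrDr mulrDl opprD addrACA. Qed.
Lemma lie_sumr x (I : Type) (r : seq I) (P : pred I) (F : I -> R) :
  lie x (\sum_(i <- r | P i) F i) = \sum_(i <- r | P i) lie x (F i).
Proof. by apply: (big_morph (lie x)) => [y z|]; rewrite ?lieDr ?lie0r. Qed.
Lemma lie_suml x (I : Type) (r : seq I) (P : pred I) (F : I -> R) :
  lie (\sum_(i <- r | P i) F i) x = \sum_(i <- r | P i) lie (F i) x.
Proof. by apply: (big_morph (lie^~ x)) => [y z|]; rewrite ?lieDl ?lie0l. Qed.
Lemma lie_jacobi x y z : lie x (lie y z) = lie (lie x y) z - lie (lie x z) y.
Proof.
rewrite /lie !mulrBr !mulrBl !mulrA !opprB.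
rewrite [RHS]addrACA [_ + (y * x * z - _)]addrA subrK.
rewrite [z * y * x - _ + _]addrA subrK.
by rewrite [LHS]addrACA [RHS]addrACA [- (y * z * x) + _]addrC.
Qed.

End LieBracket.

(* A graded Lie ring is given as a family A of additive subgroups, indexed by
   the residues i < n. *)
Section Kreknin.
Variables (R : pzRingType) (n : nat).
Implicit Types (A B : nat -> set R).

Definition graded A :=
  [/\ forall i, (i < n)%N -> A i 0,
      forall i x y, (i < n)%N -> A i x -> A i y -> A i (x - y),
      forall i j x y, (i < n)%N -> (j < n)%N -> A i x -> A j y ->
        A ((i + j) %% n)%N (lie x y) &
      forall x, A 0%N x -> x = 0].

Inductive derived A : nat -> set R :=
| derived0 c : (c < n)%N -> derived A c 0
| derivedB c x y : derived A c x -> derived A c y -> derived A c (x - y)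
| derived_lie i j x y : (i < n)%N -> (j < n)%N -> A i x -> A j y ->
    derived A ((i + j) %% n)%N (lie x y).

(** Kreknin's auxiliary subrings: as [k] grows fewer degrees supply generators, and at [k = n] none
    do, so that only 0 remains. *)
Inductive generated k A : nat -> set R :=
| generated0 c : (c < n)%N -> generated k A c 0
| generated_base i x : (k <= i < n)%N -> A i x -> generated k A i x
| generatedB c x y : generated k A c x -> generated k A c y ->
    generated k A c (x - y)
| generated_lie i j x y : generated k A i x -> generated k A j y ->
    generated k A ((i + j) %% n)%N (lie x y).

(** It mediates between brackets with [generated k A] and, in degree [k], the smaller ring
    [generated k.+1 A]. *)
Inductive products k A : nat -> set R :=
| products0 c : (c < n)%N -> products k A c 0
| productsB c x y : products k A c x -> products k A c y -> products k A c (x - y)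
| products_lie i j x y : (i < n)%N -> (k <= j < n)%N -> A i x -> A j y ->
    products k A ((i + j) %% n)%N (lie x y).

Hypothesis n_gt0 : (0 < n)%N.

Lemma generated_lt k A c x : generated k A c x -> (c < n)%N.
Proof. by elim=> // [i y /andP[]//|i j y z *]; rewrite ltn_mod. Qed.

Lemma derived_sub A c : graded A -> derived A c `<=` A c.
Proof.
case=> A0 AB AL _ x Dx; suff: (c < n)%N /\ A c x by case.
elim: Dx => {c x} [c cn|c x y _ [cn Ax] _ [_ Ay]|i j x y *].
- by split=> //; apply: A0.
- by split=> //; apply: AB.
- by split; [rewrite ltn_mod | apply: AL].
Qed.

Lemma graded_derived A : graded A -> graded (derived A).
Proof.
move=> gA; split=> [i|i x y _|i j x y ilt jlt Ax Ay|x /(derived_sub gA)].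
- exact: derived0.
- exact: derivedB.
- by apply: derived_lie => //; apply: derived_sub.
- by case: gA => _ _ _; apply.
Qed.

Lemma graded_iter A s : graded A -> graded (iter s derived A).
Proof. by move=> gA; elim: s => //= s; apply: graded_derived. Qed.

Lemma iter_derived_sub A s c : graded A -> iter s derived A c `<=` A c.
Proof.
move=> gA; elim: s => //= s IHs.
by apply: subset_trans IHs; apply: derived_sub; apply: graded_iter.
Qed.

Lemma generated_sub k A c : graded A -> generated k A c `<=` A c.
Proof.
case=> A0 AB AL _ x Gx.
elim: Gx => {c x} [c cn|i x _ //|c x y /generated_lt cn Ax _ Ay|i j x y gx Ax gy Ay].
- exact: A0.
- exact: AB.
- by apply: AL => //; [apply: generated_lt gx | apply: generated_lt gy].
Qed.

Lemma generated_mono k k' A B c : (forall i, (k <= i < n)%N -> A i `<=` generated k' B i) ->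
  generated k A c `<=` generated k' B c.
Proof.
move=> AB x; elim=> {c x} [c|i x /AB|c x y _ Bx _|i j x y _ Bx _].
- exact: generated0.
- exact.
- exact: generatedB.
- exact: generated_lie.
Qed.

(** By the Jacobi identity, bracketing with [y, z] reduces to bracketing successively with y and z
    in both orders; generators are peeled off one at a time while the left factor stays in [A]. *)
Lemma lie_generated_products k A i j x y : graded A -> (i < n)%N -> A i x ->
  generated k A j y -> products k A ((i + j) %% n)%N (lie x y).
Proof.
move=> gA ilt Ax Gy; elim: Gy i x ilt Ax => {j y}
  [c cn|j y /andP[kj jn] Ay|c y z _ IHy _ IHz|j l y z Gy IHy Gz IHz] i x ilt Ax.
- by rewrite lie0r; apply: products0; rewrite ltn_mod.
- by apply: products_lie => //; rewrite kj.
- by rewrite lieBr; apply: productsB; [apply: IHy | apply: IHz].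
- have [_ _ AL _] := gA; rewrite lie_jacobi; apply: productsB.
  + have -> : ((i + (j + l) %% n) %% n = ((i + j) %% n + l) %% n)%N.
      by rewrite modnDmr modnDml addnA.
    apply: IHz; rewrite ?ltn_mod //; apply: AL => //.
      exact: generated_lt Gy.
    exact: generated_sub Gy.
  + have -> : ((i + (j + l) %% n) %% n = ((i + l) %% n + j) %% n)%N.
      by rewrite modnDmr modnDml addnAC addnA.
    apply: IHy; rewrite ?ltn_mod //; apply: AL => //.
      exact: generated_lt Gz.
    exact: generated_sub Gz.
Qed.

(* If i + j = k mod n with j = k then i = 0, and if j > k then i > k. *)
Lemma products_generated k A : graded A -> (k < n)%N ->
  products k A k `<=` generated k.+1 A k.
Proof.
move=> gA kn x Px.
suff H c y : products k A c y -> c = k -> generated k.+1 A c y by apply: H.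
elim=> {c y Px} [c cn _|c y z _ IHy _ IHz ck|i j y z ilt /andP[kj jn] Ay Az].
- exact: generated0.
- by apply: generatedB; [apply: IHy | apply: IHz].
have ij2n : (i + j < n + n)%N by rewrite -addnS leq_add // ltnW.
have ijE : ((i + j) %% n = if i + j < n then i + j else i + j - n)%N.
  case: ltnP => ijn; first by rewrite modn_small.
  by rewrite -{1}(subnK ijn) modnDr modn_small // ltn_subLR.
move: kj; rewrite leq_eqVlt => /predU1P[kj|kj] ijk.
  have i0 : i = 0%N by move: ijk; rewrite ijE -kj; case: ltnP; lia.
  have -> : y = 0 by case: gA => _ _ _; apply; rewrite -i0.
  by rewrite lie0l; apply: generated0; rewrite ltn_mod.
apply: generated_lie; apply: generated_base => //; last by rewrite kj.
by rewrite ilt andbT; move: ijk; rewrite ijE; case: ltnP; lia.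
Qed.

(** Equal to 2^k - 1. The successor counts one further derived term, whose elements are sums of
    brackets. *)
Fixpoint kreknin_bound k :=
  if k is k'.+1 then (kreknin_bound k' + (kreknin_bound k').+1)%N else 0%N.

(* The terms of the derived series lose their low-degree generators one by one:
   the bound doubles at each degree because the inductive hypothesis is applied
   to A and again to a term of its derived series. *)
Lemma kreknin_step k A i : graded A -> (k < n)%N -> (i < n)%N ->
  iter (kreknin_bound k) derived A i `<=` generated k.+1 A i.
Proof.
elim: k A i => [|k IHk] A i gA kn ilt x.
  move=> /= Ax; case: (posnP i) => [i0|i0]; last first.
    by apply: generated_base; rewrite ?i0.
  have -> : x = 0 by case: gA => _ _ _; apply; rewrite -i0.
  exact: generated0.
rewrite /= iterD /=; set B := iter _ _ A.
have gB : graded B by apply: graded_iter.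
have BA c : B c `<=` A c by apply: iter_derived_sub.
move/(IHk (derived B) i (graded_derived gB) (ltnW kn) ilt).
apply: generated_mono => j /andP[kj jn] y.
(* Degrees above k + 1 are still allowed as generators. In degree k + 1 the element is built from
   brackets [z, t] with t in [generated k.+1 A] by induction; these are products, which in that
   degree are generated by higher degrees. *)
move: kj; rewrite leq_eqVlt => /predU1P[<-|kj]; last first.
  move=> Dy; apply: generated_base; first by rewrite kj.
  by apply: BA; apply: derived_sub Dy.
move=> Dy; apply: products_generated => //; move: Dy.
suff H c z : derived B c z -> products k.+1 A c z by exact: H.
elim=> {c z} [c|c z t _ Pz _|a b z t an bn Bz Bt].
- exact: products0.
- exact: productsB.
- apply: lie_generated_products => //; first exact: BA.
  by apply: (IHk A b gA (ltnW kn) bn).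
Qed.

Lemma generated_n A c x : generated n A c x -> x = 0.
Proof.
elim=> {c x} [//|i x|c x y _ -> _ ->|i j x y _ -> _ _]; last 2 first.
- by rewrite subrr.
- by rewrite lie0l.
by case: leqP => //= ni; rewrite ltnNge ni.
Qed.

Theorem kreknin A i x : graded A -> (i < n)%N ->
  iter (kreknin_bound n.-1) derived A i x -> x = 0.
Proof.
move=> gA ilt /(kreknin_step gA _ ilt); rewrite ltn_predL prednK // => /(_ n_gt0).
exact: generated_n.
Qed.

End Kreknin.

(** * Matrix Lie algebras with a fixed-point-free automorphism of finite order *)

Section FixedPointFree.
Variables (k : closedFieldType) (pchar_k : [pchar k] =i pred0).

Lemma prim_root_exists m : (0 < m)%N -> exists z : k, m.-primitive_root z.
Proof.
pose p : {poly k} := 'X^m - 1; have [r Dp] := closed_field_poly_normal p.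
move=> m_gt0; rewrite (monicP _) ?monicXnsubC // scale1r in Dp.
have rm1 : all m.-unity_root r by apply/allP=> z; rewrite -root_prod_XsubC -Dp.
have sz_r : (m < (size r).+1)%N.
  by rewrite -(size_prod_XsubC r id) -Dp size_XnsubC.
have [|z _ prim_z] := hasP (has_prim_root m_gt0 rm1 _ sz_r); last by exists z.
by rewrite -separable_prod_XsubC -Dp separable_Xn_sub_1 // natf_eq0 // -lt0n.
Qed.

Variables (N m : nat) (a : 'M[k]_N) (L : set 'M[k]_N).
Hypotheses (m_gt0 : (0 < m)%N) (am : a ^+ m = 1).
Hypothesis L0 : L 0.
Hypothesis LB : forall x y, L x -> L y -> L (x - y).
Hypothesis LZ : forall c x, L x -> L (c *: x).
Hypothesis L_lie : forall x y, L x -> L y -> L (lie x y).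
Hypothesis LJ : forall x, L x -> L (a * x * a ^+ m.-1).
Hypothesis L_fixed : forall x, L x -> a * x = x * a -> x = 0.

Let LD x y : L x -> L y -> L (x + y).
Proof. by move=> Lx Ly; rewrite -[y]opprK; apply: LB => //; rewrite -sub0r; apply: LB. Qed.

Let scalerMl c (x y : 'M[k]_N) : (c *: x) * y = c *: (x * y).
Proof. by rewrite -!mulmxE scalemxAl. Qed.
Let scalerMr c (x y : 'M[k]_N) : x * (c *: y) = c *: (x * y).
Proof. by rewrite -!mulmxE scalemxAr. Qed.

(** Conjugation by [a] is diagonalizable with m-th roots of unity as eigenvalues. Its eigenspaces
    grade [L] by Z/m, and degree 0 consists of the fixed vectors, so Kreknin's theorem applies. *)
Lemma fixed_point_free_solvable :
  exists s, forall x, iter s (@lie_brackets _) L x -> x = 0.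
Proof.
have [z zP] := prim_root_exists m_gt0.
(* The eigenspace of conjugation by [a] for z^i, written without an inverse. *)
pose A i : set 'M[k]_N := [set x | L x /\ a * x = z ^+ i *: (x * a)].
have gA : graded m A.
  split=> [i _|i x y _ [Lx ax] [Ly ay]|i j x y _ _ [Lx ax] [Ly ay]|x [Lx ax]].
  - by split=> //; rewrite mulr0 mul0r scaler0.
  - by split; [exact: LB | rewrite mulrBr ax ay mulrBl scalerBr].
  - have H u v i' j' : a * u = z ^+ i' *: (u * a) -> a * v = z ^+ j' *: (v * a) ->
        a * (u * v) = z ^+ (i' + j') *: (u * v * a).
      move=> au av; rewrite mulrA au scalerMl -mulrA av scalerMr scalerA.
      by rewrite exprD mulrA.
    split; first exact: L_lie.
    rewrite prim_expr_mod // /lie mulrBr mulrBl scalerBr (H x y i j) //.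
    by rewrite (H y x j i) // addnC.
  - by apply: L_fixed => //; rewrite ax expr0 scale1r.
exists (kreknin_bound m.-1) => x Lx.
(* Kreknin's theorem concerns homogeneous elements, so each iterated bracket is split into
   components lying in the graded derived series. *)
suff [X XA ->] : exists2 X : nat -> 'M[k]_N,
    forall i, (i < m)%N -> iter (kreknin_bound m.-1) (derived m) A i (X i) &
    x = \sum_(i < m) X i.
  by rewrite big1 // => i _; apply: (kreknin m_gt0 gA) (XA i _).
elim: (kreknin_bound m.-1) x Lx => [x Lx|s IHs x [y Ly [t Lt <-]]] /=; last first.
  have [Y YA ->] := IHs y Ly; have [T TA ->] := IHs t Lt.
  set B := iter s _ A in YA TA *.
  exists (fun c => \sum_(i < m) \sum_(j < m | ((i + j) %% m == c)%N) lie (Y i) (T j)).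
    move=> c cm.
    have DD u v : derived m B c u -> derived m B c v -> derived m B c (u + v).
      move=> Du Dv; rewrite -[v]opprK -[- v]sub0r; apply: derivedB => //.
      by apply: derivedB => //; apply: derived0.
    have D0 := derived0 B cm.
    apply: big_ind => // i _; apply: big_ind => // j /eqP <-.
    by apply: derived_lie => //; [apply: YA | apply: TA].
  rewrite lie_suml exchange_big /=; apply: eq_bigr => i _.
  rewrite lie_sumr (exchange_big_dep xpredT) //=; apply: eq_bigr => j _.
  by rewrite (big_pred1 (Ordinal (ltn_pmod (i + j) m_gt0))) // => c; rewrite eq_sym.
pose b := a ^+ m.-1.
have ab : a * b = 1 by rewrite -exprS prednK.
have ba : b * a = 1 by rewrite -exprSr prednK.
have bm : b ^+ m = 1 by rewrite -exprM mulnC exprM am expr1n.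
pose sg j : 'M[k]_N := a ^+ j * x * b ^+ j.
have Lsg j : L (sg j).
  elim: j => [|j IHj]; first by rewrite /sg !expr0 mul1r mulr1.
  by move: (LJ IHj); rewrite /sg exprS exprSr !mulrA.
have mk0 : m%:R != 0 :> k by rewrite natf_eq0 // -lt0n.
(* A discrete Fourier transform: the average over j of z^(-ij) a^j x a^(-j) is the component of x
   for the eigenvalue z^i. *)
pose F i j := (z^-1 ^+ i) ^+ j *: sg j.
have z0 : z != 0.
  apply/eqP => z0; have /eqP := prim_expr_order zP.
  by rewrite z0 expr0n gtn_eqF // eq_sym oner_eq0.
have wm : z^-1 ^+ m = 1 by rewrite exprVn prim_expr_order // invr1.
exists (fun i => m%:R^-1 *: \sum_(j < m) F i j).
  move=> i im; split.
    by apply: LZ; apply: big_ind => // j _; apply: LZ.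
  rewrite scalerMl scalerMr scalerA mulrC -scalerA; congr (_ *: _).
  have shift : \sum_(j < m) F i j.+1 = \sum_(j < m) F i j.
    have : F i m = F i 0%N.
      by rewrite /F /sg am bm !expr0 exprAC wm expr1n.
    move: m_gt0; case: (m) => // m' _ Fm.
    by rewrite big_ord_recr [RHS]big_ord_recl /= Fm addrC.
  rewrite mulr_sumr -shift mulr_suml scaler_sumr; apply: eq_bigr => j _.
  rewrite /F scalerMr scalerMl scalerA; congr (_ *: _).
    by rewrite exprS mulrA -exprMn mulfV // expr1n mul1r.
  by rewrite /sg exprS exprSr -!mulrA ba mulr1.
rewrite -scaler_sumr exchange_big /=.
have -> : \sum_(j < m) \sum_(i < m) F i j = m%:R *: x; last first.
  by rewrite scalerA mulVf // scale1r.
rewrite (bigD1 (Ordinal m_gt0)) //= [X in _ + X]big1 => [|j j0].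
  rewrite addr0 (eq_bigr (fun=> x)) => [|i _]; last first.
    by rewrite /F /sg !expr0 mul1r mulr1 scale1r.
  by rewrite sumr_const card_ord scaler_nat.
rewrite -scaler_suml.
suff -> : \sum_(i < m) (z^-1 ^+ i) ^+ j = 0 by rewrite scale0r.
have zj : z^-1 ^+ j - 1 != 0.
  rewrite subr_eq0 exprVn invr_eq1 -(prim_order_dvd zP).
  by apply: contra j0 => /eqP; rewrite modn_small // => /eqP.
apply: (mulfI zj); rewrite mulr0.
under eq_bigr do rewrite exprAC.
by rewrite -subrX1 exprAC wm expr1n subrr.
Qed.

End FixedPointFree.

(** * Regular functions on an affine algebraic group *)

Lemma meval_comp (k : closedFieldType) m n (p : {mpoly k[m]}) (q : 'I_m -> {mpoly k[n]})
    (v : 'I_n -> k) (w : 'I_m -> k) : (forall i, w i = (q i).@[v]) ->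
  (p \mPo [tuple q i | i < m]).@[v] = p.@[w].
Proof.
move=> wE; have -> : w = fun i => (tnth [tuple q i | i < m] i).@[v].
  by apply/funext => i; rewrite tnth_mktuple wE.
exact: comp_mpoly_meval.
Qed.

Section RegularFunctions.
Variables (k : closedFieldType) (G : affine_algebraic_group k).
Local Notation n := (ambient_dim G).
Local Notation H := (identity_component G).
Implicit Types (x y g h : G) (f : G -> k) (D : set G).

Definition coords x : 'I_n -> k := (embedding x : 'rV[k]_n) 0.

Lemma coords_inj x y : coords x =1 coords y -> x = y.
Proof. by move=> xy; apply: embedding_inj; apply/rowP. Qed.

Definition regular D f := exists p : {mpoly k[n]}, forall x, D x -> f x = p.@[coords x].

Lemma regular_eq D f f' : (forall x, D x -> f' x = f x) -> regular D f -> regular D f'.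
Proof. by move=> ff' [p pE]; exists p => x Dx; rewrite ff' ?pE. Qed.

Lemma regularS D D' f : D `<=` D' -> regular D' f -> regular D f.
Proof. by move=> DD' [p pE]; exists p => x Dx; apply/pE/DD'. Qed.

Lemma regularC D c : regular D (fun=> c).
Proof. by exists c%:MP => x _; rewrite mevalC. Qed.

Lemma regular_coord D i : regular D (coords^~ i).
Proof. by exists 'X_i => x _; rewrite mevalXU. Qed.

Lemma regularD D f f' : regular D f -> regular D f' -> regular D (fun x => f x + f' x).
Proof. by move=> [p pE] [q qE]; exists (p + q) => x Dx; rewrite mevalD pE ?qE. Qed.

Lemma regularM D f f' : regular D f -> regular D f' -> regular D (fun x => f x * f' x).
Proof. by move=> [p pE] [q qE]; exists (p * q) => x Dx; rewrite mevalM pE ?qE. Qed.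

Lemma regularN D f : regular D f -> regular D (fun x => - f x).
Proof. by move=> [p pE]; exists (- p) => x Dx; rewrite mevalN pE. Qed.

Lemma regularB D f f' : regular D f -> regular D f' -> regular D (fun x => f x - f' x).
Proof. by move=> Df Df'; apply: regularD => //; apply: regularN. Qed.

Lemma regular_sum D (I : Type) (r : seq I) (P : pred I) (F : I -> G -> k) :
  (forall i, P i -> regular D (F i)) -> regular D (fun x => \sum_(i <- r | P i) F i x).
Proof.
move=> DF; elim: r => [|i r IHr].
  by apply: regular_eq (regularC D 0) => x _; rewrite big_nil.
case Pi: (P i); last by apply: regular_eq IHr => x _; rewrite big_cons Pi.
by apply: regular_eq (regularD (DF i Pi) IHr) => x _; rewrite big_cons Pi.
Qed.

Lemma regular_horner D (Q : {poly k}) f : regular D f -> regular D (fun x => Q.[f x]).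
Proof.
move=> Df; elim/poly_ind: Q => [|Q c IHQ].
  by apply: regular_eq (regularC D 0) => x _; rewrite horner0.
by apply: regular_eq (regularD (regularM IHQ Df) (regularC D c)) => x _; rewrite !hornerE.
Qed.

Lemma regular_comp D D' (phi : G -> G) f : (forall i, regular D (fun x => coords (phi x) i)) ->
  (forall x, D x -> D' (phi x)) -> regular D' f -> regular D (f \o phi).
Proof.
move=> phireg DD' [p pE]; have [q qE] := choice phireg.
exists (p \mPo [tuple q i | i < n]) => x Dx.
by rewrite /= pE; [apply/esym/meval_comp => i; rewrite qE | exact: DD'].
Qed.

(** The coproduct of the coordinate ring: each monomial of p(xy) in the doubled variables splits
    into one in x times one in y. *)
Lemma comultiplication (p : {mpoly k[n]}) :
  exists (r : nat) (a b : 'I_r -> {mpoly k[n]}), forall x y,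
    p.@[coords (x * y)%g] = \sum_i (a i).@[coords x] * (b i).@[coords y].
Proof.
have [P PE] := mul_morphism G.
pose q := p \mPo [tuple P i | i < n].
pose m i := nth 0%MM (msupp q) i.
exists (size (msupp q)).
exists (fun i => q@_(m i) *: 'X_[[multinom m i (lshift n j) | j < n]]).
exists (fun i => 'X_[[multinom m i (rshift n j) | j < n]]) => x y.
have -> : p.@[coords (x * y)%g] = q.@[row_mx (embedding x) (embedding y) 0].
  by apply/esym/meval_comp => i; rewrite -PE.
rewrite mevalE (big_nth 0%MM) big_mkord; apply: eq_bigr => i _.
rewrite mevalZ !mevalX -mulrA; congr (_ * _).
rewrite big_split_ord /=; congr (_ * _); apply: eq_bigr => j _.
  by rewrite mnmE row_mxEl.
by rewrite mnmE row_mxEr.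
Qed.

Lemma regular_mull g f : regular setT f -> regular setT (fun x => f (g * x)%g).
Proof.
move=> [p pE]; have [r [a [b abE]]] := comultiplication p.
apply: (@regular_eq _ (fun x => \sum_i (a i).@[coords g] * (b i).@[coords x])).
  by move=> x _; rewrite pE.
by apply: regular_sum => i _; apply: regularM; [exact: regularC | exists (b i)].
Qed.

Lemma regular_mulr g f : regular setT f -> regular setT (fun x => f (x * g)%g).
Proof.
move=> [p pE]; have [r [a [b abE]]] := comultiplication p.
apply: (@regular_eq _ (fun x => \sum_i (a i).@[coords x] * (b i).@[coords g])).
  by move=> x _; rewrite pE.
by apply: regular_sum => i _; apply: regularM; [exists (a i) | exact: regularC].
Qed.

Lemma regular_inv f : regular setT f -> regular setT (fun x => f x^-1%g).
Proof.
move=> freg; have [P PE] := inv_morphism G.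
apply: (@regular_comp _ setT (fun x => x^-1%g)) => // i.
by exists (P i) => x _; rewrite /coords PE.
Qed.

Definition zariski_closed (A : set G) := exists S : set {mpoly k[n]},
  A = [set x | forall p, S p -> p.@[coords x] = 0].

Local Notation W := (initial_topology (@embedding k G)).

Lemma zariski_closedE (A : set G) : zariski_closed A <-> closed (A : set W).
Proof.
split=> [[S ->]|].
  have cont := @initial_continuous _ _ (@embedding k G).
  move/continuous_closedP: cont => /(_ (zero_locus S)) cl; apply: cl.
  by apply/zariski_closedP; exists S.
rewrite -openC => -[U [S _ <-] UA]; exists S.
by apply: setC_inj; rewrite -UA.
Qed.

Lemma zariski_closed_zeros (I : Type) (f : I -> G -> k) : (forall i, regular setT (f i)) ->
  zariski_closed [set x | forall i, f i x = 0].
Proof.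
move=> /choice[p pE]; exists (range p); apply/seteqP; split=> x /= fx.
  by move=> _ [i _ <-]; rewrite -pE //; apply: fx.
by move=> i; rewrite pE //; apply: fx; exists i.
Qed.

Lemma continuous_regular (phi : G -> G) :
  (forall f, regular setT f -> regular setT (fun x => f (phi x))) -> continuous (phi : W -> W).
Proof.
move=> phireg; apply/continuous_closedP => A /zariski_closedE[S ->].
apply/zariski_closedE.
have -> : phi @^-1` [set x | forall p, S p -> p.@[coords x] = 0] =
    [set x | forall p : {p | S p}, (sval p).@[coords (phi x)] = 0].
  apply/seteqP; split=> [x Sx [p Sp]|x Sx p Sp]; first exact: (Sx p Sp).
  exact: (Sx (exist _ p Sp)).
apply: zariski_closed_zeros => p.
by have := phireg (fun x => (sval p).@[coords x]); apply; exists (sval p).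
Qed.

Lemma component_regular (phi : G -> G) x :
  (forall f, regular setT f -> regular setT (fun x => f (phi x))) ->
  forall y, component x y -> component (phi x) (phi y).
Proof.
move=> phireg y xy.
suff: phi @` component x `<=` component (phi x) by apply; exists y.
apply: (@connected_component_max W) => //.
  by exists x => //; apply: connected_component_refl.
apply: (@connected_continuous_connected W W).
  exact: component_connected.
exact/continuous_subspaceT/continuous_regular.
Qed.

Lemma idcomp1 : H 1%g.
Proof. exact: connected_component_refl. Qed.

Lemma component_mull g x y : component x y -> component (g * x)%g (g * y)%g.
Proof. by apply: (@component_regular (fun z => g * z)%g) => f; apply: regular_mull. Qed.

Lemma idcompM x y : H x -> H y -> H (x * y)%g.
Proof.
move=> Hx /(component_mull x); rewrite mulg1; exact: connected_component_trans.
Qed.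

Lemma idcompV x : H x -> H x^-1%g.
Proof.
move=> /(component_mull x^-1%g); rewrite mulg1 mulVg; exact: connected_component_sym.
Qed.

Lemma idcompJ g x : H x -> H (g * x * g^-1)%g.
Proof.
move=> Hx; have := @component_regular (fun z => g * z * g^-1)%g 1%g _ x Hx.
rewrite mulg1 mulgV; apply=> f freg.
exact: (regular_mull g (regular_mulr g^-1%g freg)).
Qed.

Lemma component_coset x y : H y -> component x (x * y)%g.
Proof. by move=> /(component_mull x); rewrite mulg1. Qed.

(** Connectedness in terms of functions: the common zeros of the [f i] and those of the [f' j] are
    closed sets that partition H, and the first contains 1. *)
Lemma idcomp_connected (I J : Type) (f : I -> G -> k) (f' : J -> G -> k) :
  (forall i, regular H (f i)) -> (forall j, regular H (f' j)) ->
  (forall i, f i 1%g = 0) ->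
  (forall x, H x -> (forall i, f i x = 0) \/ (forall j, f' j x = 0)) ->
  (forall x, H x -> (forall i, f i x = 0) -> exists j, f' j x != 0) ->
  forall x, H x -> forall i, f i x = 0.
Proof.
move=> /choice[p pE] /choice[q qE] f1 cover disj x Hx i.
pose A : set W := [set x | forall i, (p i).@[coords x] = 0].
pose B : set W := [set x | forall j, (q j).@[coords x] = 0].
have cA : closed A.
  by apply/zariski_closedE/zariski_closed_zeros => j; exists (p j).
have cB : closed B.
  by apply/zariski_closedE/zariski_closed_zeros => j; exists (q j).
have AE y : H y -> A y <-> forall i, f i y = 0.
  by move=> Hy; split=> Ay j; [rewrite pE | rewrite -pE].
suff HA : H `&` A = H by rewrite -HA in Hx; case: Hx => Hx /AE ->.
have conH : connected (H : set W) by exact: component_connected.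
apply: conH; last by exists A.
  by exists 1%g; split; [exact: idcomp1 | apply/AE => //; exact: idcomp1].
exists (~` B); first by rewrite openC.
apply/seteqP; split=> y [Hy Ay]; split=> //.
  by have [j] := disj y Hy ((AE y Hy).1 Ay); rewrite qE // => + Byj; rewrite Byj eqxx.
case: (cover y Hy) => [fy|f'y]; first exact/(AE y Hy).
by case: Ay => j; rewrite -qE.
Qed.

(** Equations in the ambient space itself, whose points are the tuples that quantifier elimination
    ranges over. *)
Lemma idcomp_zero_locus : exists S : set {mpoly k[n]}, forall v : 'rV[k]_n,
  (forall p, S p -> p.@[v 0] = 0) <-> exists2 x, H x & v = embedding x.
Proof.
have [S SE] := (zariski_closedP _).1 (@embedding_closed k G).
have /zariski_closedE[S' S'E] : closed (H : set W).
  by apply: component_closed; exact: closedT.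
exists (S `|` S') => v; split=> [vS|[x Hx -> p [Sp|S'p]]].
- have : range (@embedding k G) v by rewrite SE => p Sp; apply: vS; left.
  case=> x _ xv.
  exists x => //; rewrite S'E => p S'p; rewrite /coords xv; apply: vS; right.
  exact: S'p.
- have : range (@embedding k G) (embedding x) by exists x.
  by rewrite SE => /(_ p Sp).
- by move: Hx; rewrite S'E => /(_ p S'p).
Qed.

End RegularFunctions.

(** * Linear representations *)

(** Otherwise every finite list from [S] has a zero at which another member of [S] does not vanish.
    In a sequence of such members none is a combination of its predecessors, against the Hilbert
    basis theorem. *)
Lemma finite_zero_locus (k : fieldType) n (S : set {mpoly k[n]}) :
  exists2 ps : seq {mpoly k[n]}, (forall p, p \in ps -> S p) &
    forall v, (forall p, p \in ps -> p.@[v] = 0) -> forall p, S p -> p.@[v] = 0.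
Proof.
apply: contrapT => nofin.
have step (ps : seq {mpoly k[n]}) : exists pv : {mpoly k[n]} * ('I_n -> k),
    (forall q, q \in ps -> S q) ->
    [/\ S pv.1, forall q, q \in ps -> q.@[pv.2] = 0 & pv.1.@[pv.2] != 0].
  have [psS|psS] := pselect (forall q, q \in ps -> S q); last by exists (0, fun=> 0).
  apply: contrapT => stuck; apply: nofin; exists ps => // v vps p Sp.
  by apply: contrapT => /eqP pv; apply: stuck; exists (p, v).
have [next nextP] := choice step.
pose L := fix L i := if i is j.+1 then rcons (L j) (next (L j)).1 else [::].
have LS j q : q \in L j -> S q.
  elim: j q => //= j IHj q; rewrite mem_rcons inE => /predU1P[->|/IHj //].
  by case: (nextP _ IHj).
have LE i j : (i < j)%N -> (next (L i)).1 \in L j.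
  elim: j => // j IHj; rewrite ltnS leq_eqVlt => /predU1P[->|/IHj ij] /=.
    by rewrite mem_rcons mem_head.
  by rewrite mem_rcons inE ij orbT.
have [j [c pj]] := @hilbert_basis k n (fun i => (next (L i)).1).
have [_ Lj /negP] := nextP (L j) (LS j); apply.
apply/eqP; rewrite pj raddf_sum big1 //= => i _.
by rewrite mevalM (Lj (next (L i)).1) ?mulr0 // LE.
Qed.

Section ConstantFunctions.
Variables (k : closedFieldType) (pchar_k : [pchar k] =i pred0).
Variable G : affine_algebraic_group k.
Local Notation n := (ambient_dim G).
Local Notation H := (identity_component G).

(** Write [Q] as (X - f(1))^m q with q(f(1)) nonzero: the sets f = f(1) and q(f) = 0 are closed,
    disjoint and cover H. *)
Lemma finite_valued_constant (f : G -> k) (Q : {poly k}) : regular H f -> Q != 0 ->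
  (forall x, H x -> root Q (f x)) -> forall x, H x -> f x = f 1%g.
Proof.
move=> freg Q0 Qf x Hx.
have [m [q /implyP/(_ Q0) q1 QE]] := multiplicity_XsubC Q (f 1%g).
have reg1 : regular H (fun x => f x - f 1%g) by apply: regularB => //; apply: regularC.
have := @idcomp_connected _ _ unit unit (fun=> fun x => f x - f 1%g) (fun=> fun x => q.[f x]).
move=> /(_ (fun=> reg1) (fun=> regular_horner q freg) (fun=> subrr _)) conn.
apply/eqP; rewrite -subr_eq0; apply/eqP; apply: conn Hx tt => y Hy; last first.
  by move=> /(_ tt)/eqP; rewrite subr_eq0 => /eqP ->; exists tt.
have := Qf y Hy; rewrite QE rootM => /orP[/rootP qy|]; first by right.
by rewrite rootE horner_exp !hornerE expf_eq0 => /andP[_ /eqP ->]; left.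
Qed.

Lemma integral_valued_constant (f : G -> k) : regular H f ->
  (forall x, H x -> integralOver (intr : int -> k) (f x)) ->
  forall x, H x -> f x = f 1%g.
Proof.
move=> freg fint; have [S SP] := idcomp_zero_locus G.
have [ps psS psP] := finite_zero_locus S.
have [p pE] := freg.
have tupP (e : n.-tuple k) : (forall q, q \in ps -> q.@[tnth e] = 0) ->
    exists2 x, H x & tnth e =1 coords x.
  move=> eps; have [|x Hx xe] := (SP (\row_i tnth e i)).1.
    by move=> q Sq; rewrite -(psP _ eps q Sq); apply: meval_eq => i; rewrite mxE.
  by exists x => // i; rewrite /coords -xe mxE.
have [Q Q0 [QP|QP]] := image_finite_or_cofinite ps p.
  apply: (finite_valued_constant freg Q0) => x Hx.
  have xE : tnth [tuple coords x i | i < n] =1 coords x by move=> i; rewrite tnth_mktuple.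
  rewrite pE // -(meval_eq p xE); apply: QP => q /psS Sq.
  by rewrite (meval_eq _ xE); apply: (SP (embedding x)).2 Sq; exists x.
(* The numbers 1/2 + j are distinct in characteristic 0, so one of them avoids the roots of [Q] and
   is a value of [f]; subtracting j would make 1/2 integral. *)
have [|] := pselect (exists j : nat, ~~ root Q (2^-1 + j%:R)); last first.
  move=> allroot; exfalso.
  pose s := [seq 2^-1 + j%:R | j <- iota 0 (size Q)] : seq k.
  suff : (size s < size Q)%N by rewrite size_map size_iota ltnn.
  apply: max_poly_roots => //.
  - apply/allP => _ /mapP[j _ ->]; apply: contrapT => /negP Qj.
    by apply: allroot; exists j.
  - rewrite map_inj_uniq ?iota_uniq // => i j /addrI ij.
    wlog ij_le : i j ij / (i <= j)%N.
      by move=> IH; case/orP: (leq_total i j) => ?; [apply: IH | apply/esym/IH].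
    apply/eqP; rewrite eqn_leq ij_le /= -subn_eq0 -(natf_eq0 pchar_k).
    by rewrite natrB // ij subrr.
case=> j /QP[e /tupP[x Hx ex] pj].
case: (@half_not_integral k pchar_k).
have -> : 2^-1 = f x - j%:R by rewrite pE // -(meval_eq p ex) pj addrK.
apply: integral_sub; first exact: fint.
exact: integral_nat.
Qed.

End ConstantFunctions.

Section MatrixFunctions.
Variables (k : closedFieldType) (G : affine_algebraic_group k).
Local Notation n := (ambient_dim G).
Local Notation H := (identity_component G).

Definition mxregular (D : set G) p q (F : G -> 'M[k]_(p, q)) :=
  forall i j, regular D (fun x => F x i j).

Lemma mxregularS D D' p q (F : G -> 'M[k]_(p, q)) :
  D `<=` D' -> mxregular D' F -> mxregular D F.
Proof. by move=> DD' Freg i j; apply: regularS (Freg i j). Qed.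

Lemma mxregularC D p q (A : 'M[k]_(p, q)) : mxregular D (fun=> A).
Proof. by move=> i j; apply: regularC. Qed.

Lemma mxregularM D p q r (F : G -> 'M[k]_(p, q)) (F' : G -> 'M_(q, r)) :
  mxregular D F -> mxregular D F' -> mxregular D (fun x => F x *m F' x).
Proof.
move=> Freg F'reg i j.
apply: (@regular_eq _ _ _ (fun x => \sum_l F x i l * F' x l j)).
  by move=> x _; rewrite mxE.
by apply: regular_sum => l _; apply: regularM.
Qed.

Lemma mxregularX D p (F : G -> 'M[k]_p) m : mxregular D F -> mxregular D (fun x => F x ^+ m).
Proof.
move=> Freg; elim: m => [|m IHm]; first exact: mxregularC.
have := mxregularM Freg IHm.
by move=> FX i j; apply: regular_eq (FX i j) => x _; rewrite exprS.
Qed.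

Lemma regular_trace D p (F : G -> 'M[k]_p) : mxregular D F -> regular D (fun x => \tr (F x)).
Proof. by move=> Freg; apply: regular_sum => i _. Qed.

Definition representation N (rho : G -> 'M[k]_N) :=
  [/\ rho 1%g = 1, forall x y, rho (x * y)%g = rho x * rho y & mxregular setT rho].

(* The translates of the coordinate functions span a finite-dimensional space;
   a basis of it consists of translates by y_j whose matrix of values at some
   points x_s is invertible, which happens for a matrix of maximal size. *)
Lemma linearization : exists N (rho : G -> 'M[k]_N) (u : 'rV[k]_N) (w : 'I_n -> 'cV[k]_N),
  representation rho /\ forall x i, coords x i = (u *m rho x *m w i) 0 0.
Proof.
pose val N (xs ys : 'I_N -> G) (c : 'I_N -> 'I_n) : 'M[k]_N :=
  \matrix_(s, t) coords (xs s * ys t)%g (c t).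
pose P N := `[< exists xs ys c, @val N xs ys c \in unitmx >].
have P0 : exists N, P N.
  exists 0%N; apply/asboolP; exists (fun=> 1%g), (fun=> 1%g).
  have c0 : 'I_0 -> 'I_n by case.
  by exists c0; rewrite unitmxE det_mx00 unitr1.
have [r rP] := choice (fun i => comultiplication ('X_i : {mpoly k[n]})).
pose a i := projT1 (cid (rP i)); pose b i := projT1 (cid (projT2 (cid (rP i)))).
have abE i := projT2 (cid (projT2 (cid (rP i)))).
(* Comultiplication factors [val] through spaces of dimension [r i], which bounds its rank. *)
have [M bound] : exists M, forall N, P N -> (N <= M)%N.
  exists (\sum_i r i)%N => N /asboolP[xs [ys [c]]].
  rewrite -row_full_unit => /eqP <-.
  pose A i : 'M[k]_(N, r i) := \matrix_(s, l) (a i l).@[coords (xs s)].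
  pose B i : 'M[k]_(r i, N) := \matrix_(l, t) (if c t == i then (b i l).@[coords (ys t)] else 0).
  have -> : val N xs ys c = \sum_i A i *m B i.
    apply/matrixP => s t; rewrite mxE summxE (bigD1 (c t)) //= big1 ?addr0.
      rewrite mxE -(mevalXU (coords _)) abE; apply: eq_bigr => l _.
      by rewrite !mxE eqxx.
    move=> i /negPf ci; rewrite mxE big1 // => l _.
    by rewrite !mxE eq_sym ci mulr0.
  elim/big_rec2: _ => [|i y1 y2 _ IH]; first by rewrite mxrank0.
  apply: leq_trans (mxrank_add _ _) _; apply: leq_add => //.
  by apply: leq_trans (mxrankM_maxl _ _) (rank_leq_col _).
case: (ex_maxnP P0 bound) => N /asboolP[xs [ys [c B_unit]]] Nmax.
set B := val N xs ys c in B_unit.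
pose f x : 'rV[k]_N := \row_t coords (x * ys t)%g (c t).
pose v y i : 'cV[k]_N := \col_s coords (xs s * y)%g i.
(* Bordering [B] with [x] and [y] gives a matrix that is singular by maximality of [N]; its Schur
   complement, the difference of the two sides, is thus 0. *)
have fE x y i : coords (x * y)%g i = (f x *m invmx B *m v y i) 0 0.
  pose xs' (s : 'I_(N + 1)) := if split s is inl s' then xs s' else x.
  pose ys' (s : 'I_(N + 1)) := if split s is inl s' then ys s' else y.
  pose c' (s : 'I_(N + 1)) := if split s is inl s' then c s' else i.
  have : val (N + 1)%N xs' ys' c' \notin unitmx.
    apply/negP => B'_unit; have /Nmax : P (N + 1)%N.
      by apply/asboolP; exists xs', ys', c'.
    by rewrite addn1 ltnn.
  have -> : val (N + 1)%N xs' ys' c' = block_mx B (v y i) (f x) (coords (x * y)%g i)%:M.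
    apply/matrixP => s t; rewrite /val /block_mx !mxE /xs' /ys' /c'.
    by case: split => s'; rewrite !mxE; case: split => t'; rewrite !mxE // !ord1 eqxx.
  have -> : block_mx B (v y i) (f x) (coords (x * y)%g i)%:M =
      block_mx 1%:M 0 (f x *m invmx B) 1%:M *m
      block_mx B (v y i) 0 ((coords (x * y)%g i)%:M - f x *m invmx B *m v y i).
    rewrite mulmx_block !mul1mx !mul0mx !addr0 mulmxKV //.
    by rewrite addrC subrK.
  rewrite unitmxE det_mulmx det_lblock det_ublock !det1 !mul1r unitfE.
  rewrite mulf_eq0 negb_or -unitfE -unitmxE B_unit /= negbK det_mx11 !mxE eqxx.
  by rewrite subr_eq0 => /eqP.
pose rho y := invmx B *m \matrix_(s, t) coords (xs s * (y * ys t))%g (c t).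
have frho x y : f (x * y)%g = f x *m rho y.
  apply/rowP => t; rewrite mxE -mulgA fE mulmxA mxE [RHS]mxE.
  by apply: eq_bigr => s _; rewrite !mxE.
have Brho y : B *m rho y = \matrix_s f (xs s * y)%g.
  apply/row_matrixP => s; rewrite row_mul rowK frho; congr (_ *m _).
  by apply/rowP => t; rewrite !mxE.
exists N, rho, (f 1%g), (fun i => invmx B *m v 1%g i); split; last first.
  by move=> x i; rewrite -frho mul1g mulmxA -fE mulg1.
have Binj (A A' : 'M_N) : B *m A = B *m A' -> A = A'.
  by move/(congr1 (mulmx (invmx B))); rewrite !mulKmx.
split.
- apply: Binj; rewrite Brho mulmx1; apply/matrixP => s t; rewrite !mxE.
  by rewrite mulg1.
- move=> x y; apply: Binj; rewrite -mulmxE mulmxA !Brho.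
  by apply/row_matrixP => s; rewrite row_mul !rowK -frho mulgA.
- apply: (mxregularM (F' := fun y => \matrix_(s, t) coords (xs s * (y * ys t))%g (c t))).
    exact: mxregularC.
  move=> s t; apply: (@regular_eq _ _ _ (fun y => coords (xs s * (y * ys t))%g (c t))).
    by move=> x _; rewrite mxE.
  exact: (regular_mulr (ys t) (regular_mull (xs s) (regular_coord setT (c t)))).
Qed.

Lemma representationX N (rho : G -> 'M[k]_N) x m : representation rho ->
  rho (x ^+ m)%g = rho x ^+ m.
Proof.
case=> rho1 rhoM _; elim: m => [|m IHm]; first by rewrite expg0 expr0.
by rewrite expgS exprS rhoM IHm.
Qed.

Hypothesis pchar_k : [pchar k] =i pred0.

(** Any exponent m that kills [g] works: the traces of the powers of rho(gh) do not depend on h, so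
    all powers of rho(gh)^m have trace N, and finite order forces rho(gh)^m = 1. *)
Lemma periodic_exponent N (rho : G -> 'M[k]_N) g : representation rho ->
  (forall h, H h -> finite_order (g * h)%g) ->
  exists2 m, (0 < m)%N & forall h, H h -> rho (g * h)%g ^+ m = 1.
Proof.
move=> rep per; have [rho1 rhoM rho_reg] := rep.
have [m m_gt0] := per 1%g (idcomp1 G); rewrite mulg1 => gm; exists m => // h Hh.
have trE j : \tr (rho (g * h)%g ^+ j) = \tr (rho g ^+ j).
  rewrite -[in RHS](mulg1 g).
  apply: (integral_valued_constant pchar_k
    (f := fun x => \tr (rho (g * x)%g ^+ j))) => // [|x Hx].
    apply: regularS (@subsetT _ H) _; apply: regular_trace; apply: mxregularX => s t.
    by have := regular_mull g (rho_reg s t).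
  have [d d_gt0 gxd] := per x Hx; apply: (@trace_integral _ _ d) => //.
  by rewrite exprAC -representationX // gxd rho1 expr1n.
have [d d_gt0 ghd] := per h Hh.
apply: (@finite_order_trace _ pchar_k _ d) => // [|j].
  by rewrite exprAC -representationX // ghd rho1 expr1n.
by rewrite -exprM trE exprM -representationX // gm rho1 expr1n mxtrace1.
Qed.

End MatrixFunctions.

(** * Derivations at the identity *)

Lemma subspace_rowspace (k : fieldType) n (S : set 'rV[k]_n) : S 0 ->
  (forall u v, S u -> S v -> S (u + v)) -> (forall c u, S u -> S (c *: u)) ->
  exists A : 'M[k]_n, forall v, S v <-> (v <= A)%MS.
Proof.
move=> S0 SD SZ.
pose P r := `[< exists2 A : 'M[k]_n, forall v, (v <= A)%MS -> S v & \rank A = r >].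
have P0 : exists r, P r.
  exists 0%N; apply/asboolP; exists 0; last exact: mxrank0.
  by move=> v; rewrite submx0 => /eqP ->.
have Pn r : P r -> (r <= n)%N by move=> /asboolP[A _ <-]; exact: rank_leq_row.
case: (ex_maxnP P0 Pn) => r /asboolP[A AS Ar] rmax.
exists A => v; split=> [Sv|]; last exact: AS.
have /rmax : P (\rank (A + v)%MS).
  apply/asboolP; exists (A + v)%MS => // w /sub_addsmxP[[a b] ->] /=.
  apply: SD; first by apply: AS; apply: submxMl.
  by rewrite [b]mx11_scalar mul_scalar_mx; apply: SZ.
rewrite -Ar => le_rank; apply: submx_trans (addsmxSr A v) _.
have := mxrank_leqif_sup (addsmxSl A v); case=> + eq_rank.
by rewrite leq_eqVlt ltnNge le_rank orbF eq_rank.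
Qed.

Section Derivations.
Variables (k : closedFieldType) (pchar_k : [pchar k] =i pred0).
Variable G : affine_algebraic_group k.
Local Notation n := (ambient_dim G).
Local Notation H := (identity_component G).
Local Notation reg := (regular H).
Implicit Types (f : G -> k) (d : (G -> k) -> k).

(* Functionals are defined on all functions G -> k, but only their values on the
   functions regular on H matter. *)
Definition derivation d :=
  [/\ forall f f', reg f -> (forall x, H x -> f x = f' x) -> d f = d f',
      forall f f', reg f -> reg f' -> d (fun x => f x + f' x) = d f + d f',
      forall f f', reg f -> reg f' ->
        d (fun x => f x * f' x) = f 1%g * d f' + d f * f' 1%g &
      forall c, d (fun=> c) = 0].

Lemma regH_mull h f : H h -> reg f -> reg (fun x => f (h * x)%g).
Proof.
move=> Hh [p pE]; apply: (@regular_eq _ _ _ (fun x => p.@[coords (h * x)%g])).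
  by move=> x Hx; rewrite pE //; apply: idcompM.
apply: regularS (@subsetT _ H) _.
by have := @regular_mull _ _ h (fun x => p.@[coords x]); apply; exists p.
Qed.

Lemma derivationZ d c f : derivation d -> reg f -> d (fun x => c * f x) = c * d f.
Proof.
by case=> _ _ dM dC freg; rewrite dM ?dC ?mul0r ?addr0 //; apply: regularC.
Qed.

Lemma derivationN d f : derivation d -> reg f -> d (fun x => - f x) = - d f.
Proof.
move=> der freg; have [deq _ _ _] := der; rewrite -mulN1r -derivationZ //.
by apply: deq; [apply: regularN | move=> x _; rewrite mulN1r].
Qed.

Lemma derivationB d f f' : derivation d -> reg f -> reg f' ->
  d (fun x => f x - f' x) = d f - d f'.
Proof.
move=> der freg f'reg; have [_ dD _ _] := der.
by rewrite dD ?derivationN //; apply: regularN.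
Qed.

Lemma derivation_sum d (I : Type) (r : seq I) (F : I -> G -> k) : derivation d ->
  (forall i, reg (F i)) -> d (fun x => \sum_(i <- r) F i x) = \sum_(i <- r) d (F i).
Proof.
move=> [deq dD _ dC] Freg; elim: r => [|i r IHr].
  rewrite big_nil -(dC 0); apply/esym/deq; first exact: regularC.
  by move=> x _; rewrite big_nil.
have rreg : reg (fun x => \sum_(i <- r) F i x) by apply: regular_sum.
rewrite big_cons -IHr -dD //; apply/esym/deq; first exact: regularD.
by move=> x _; rewrite big_cons.
Qed.

(** This function is the left-invariant vector field of [d] applied to [f]; comultiplication makes
    it a combination of the a_i with coefficients d(b_i). *)
Lemma regular_derivation d f : derivation d -> reg f ->
  reg (fun h => d (fun x => f (h * x)%g)).
Proof.
move=> der [p pE]; have [r [a [b abE]]] := comultiplication p.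
have [deq _ _ _] := der.
have breg i : reg (fun x => (b i).@[coords x]) by exists (b i).
apply: (@regular_eq _ _ _ (fun h => \sum_i (a i).@[coords h] * d (fun x => (b i).@[coords x]))).
  move=> h Hh.
  rewrite (eq_bigr (fun i => d (fun x => (a i).@[coords h] * (b i).@[coords x]))); last first.
    by move=> i _; rewrite derivationZ.
  rewrite -derivation_sum //; last by move=> i; apply: regularM => //; apply: regularC.
  apply: deq; first by apply: regH_mull => //; exists p.
  by move=> x Hx; rewrite pE ?abE //; apply: idcompM.
by apply: regular_sum => i _; apply: regularM; [exists (a i) | apply: regularC].
Qed.

(** * Taylor expansion at the identity *)

Definition tcoord i (x : G) := coords x i - coords 1%g i.
Local Notation t := tcoord.

Lemma tcoord_reg i : reg (t i).
Proof. by apply: regularB; [apply: regular_coord | apply: regularC]. Qed.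

#[local] Hint Resolve tcoord_reg : core.

Lemma tcoord1 i : t i 1%g = 0. Proof. exact: subrr. Qed.

(* The j-th power of the ideal of functions on H vanishing at 1. *)
Fixpoint mpow j f := if j is j'.+1 then exists g : 'I_n -> G -> k,
    (forall i, mpow j' (g i)) /\ forall x, H x -> f x = \sum_i t i x * g i x
  else reg f.

Lemma mpow_eq j f f' : (forall x, H x -> f' x = f x) -> mpow j f -> mpow j f'.
Proof.
case: j => [|j] ff'; first exact: (regular_eq ff').
by move=> [g [gj fE]]; exists g; split=> // x Hx; rewrite ff' ?fE.
Qed.

Lemma mpow_reg j f : mpow j f -> reg f.
Proof.
elim: j f => // j IHj f [g [gj fE]]; apply: (regular_eq fE).
by apply: regular_sum => i _; apply: regularM => //; apply: IHj (gj i).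
Qed.

Lemma mpowD j f f' : mpow j f -> mpow j f' -> mpow j (fun x => f x + f' x).
Proof.
elim: j f f' => [|j IHj] f f'; first exact: regularD.
move=> [g [gj fE]] [g' [g'j f'E]]; exists (fun i x => g i x + g' i x).
split=> [i|x Hx]; first exact: IHj (gj i) (g'j i).
by rewrite fE // f'E // -big_split; apply: eq_bigr => i _; rewrite mulrDr.
Qed.

Lemma mpowMl j r f : reg r -> mpow j f -> mpow j (fun x => r x * f x).
Proof.
move=> rreg; elim: j f => [|j IHj] f; first exact: regularM.
move=> [g [gj fE]]; exists (fun i x => r x * g i x).
split=> [i|x Hx]; first exact: IHj (gj i).
by rewrite fE // mulr_sumr; apply: eq_bigr => i _; rewrite mulrCA.
Qed.

Lemma mpowZ j c f : mpow j f -> mpow j (fun x => c * f x).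
Proof. by apply: mpowMl; apply: regularC. Qed.

Lemma mpowB j f f' : mpow j f -> mpow j f' -> mpow j (fun x => f x - f' x).
Proof.
move=> fj /(mpowZ (-1)) f'j; apply: mpow_eq (mpowD fj f'j) => x _.
by rewrite mulN1r.
Qed.

Lemma mpow_cst0 j : mpow j (fun=> 0).
Proof.
elim: j => [|j IHj]; first exact: regularC.
by exists (fun _ _ => 0); split=> // x _; rewrite big1 // => i _; rewrite mulr0.
Qed.

Lemma mpow_sum j (I : Type) (r : seq I) (F : I -> G -> k) :
  (forall i, mpow j (F i)) -> mpow j (fun x => \sum_(i <- r) F i x).
Proof.
move=> Fj; elim: r => [|i r IHr].
  by apply: mpow_eq (mpow_cst0 j) => x _; rewrite big_nil.
by apply: mpow_eq (mpowD (Fj i) IHr) => x _; rewrite big_cons.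
Qed.

Lemma mpow_t j i f : mpow j f -> mpow j.+1 (fun x => t i x * f x).
Proof.
move=> fj; exists (fun l => if l == i then f else fun=> 0); split=> [l|x _].
  by case: eqP => // _; apply: mpow_cst0.
rewrite (bigD1 i) //= eqxx big1 ?addr0 // => l /negPf ->.
by rewrite mulr0.
Qed.

Lemma mpowS j f : mpow j.+1 f -> mpow j f.
Proof.
elim: j f => [|j IHj] f; first exact: mpow_reg.
by move=> [g [gj fE]]; exists g; split=> // i; apply: IHj (gj i).
Qed.

Lemma mpowM i j f f' : mpow i f -> mpow j f' -> mpow (i + j) (fun x => f x * f' x).
Proof.
elim: i f => [|i IHi] f; first exact: mpowMl.
move=> [g [gi fE]] f'j; exists (fun l x => g l x * f' x); split=> [l|x Hx].
  exact: IHi (gi l) f'j.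
by rewrite fE // mulr_suml; apply: eq_bigr => l _; rewrite mulrA.
Qed.

Definition grad1 (p : {mpoly k[n]}) : 'rV[k]_n := \row_j (p^`M(j)).@[coords 1%g].
Definition linear_part (c : 'rV[k]_n) x := \sum_j c 0 j * t j x.

Lemma linear_part_mpow c : mpow 1 (linear_part c).
Proof.
apply: mpow_sum => i; have := mpow_t i (regularC H (c 0 i) : mpow 0 _).
by apply: mpow_eq => x _; rewrite mulrC.
Qed.

Lemma linear_partD c c' x : linear_part (c + c') x = linear_part c x + linear_part c' x.
Proof. by rewrite /linear_part -big_split; apply: eq_bigr => j _; rewrite mxE mulrDl. Qed.

Lemma linear_partZ a c x : linear_part (a *: c) x = a * linear_part c x.
Proof. by rewrite /linear_part mulr_sumr; apply: eq_bigr => j _; rewrite mxE mulrA. Qed.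

Lemma grad1M p q : grad1 (p * q) = q.@[coords 1%g] *: grad1 p + p.@[coords 1%g] *: grad1 q.
Proof. by apply/rowP => j; rewrite !mxE mderivM mevalD !mevalM [_ * q.@[_]]mulrC. Qed.

Lemma taylor p :
  mpow 2 (fun x => p.@[coords x] - p.@[coords 1%g] - linear_part (grad1 p) x).
Proof.
elim/mpoly_ring_ind: p => [c|i|p q IHp IHq|p q IHp IHq].
- apply: mpow_eq (mpow_cst0 2) => x _; rewrite !mevalC subrr sub0r /linear_part big1 ?oppr0 //.
  by move=> j _; rewrite mxE mderivC meval0 mul0r.
- apply: mpow_eq (mpow_cst0 2) => x _; rewrite !mevalXU /linear_part (bigD1 i) //= big1.
    rewrite mxE mderivX mnm1E eqxx scale1r.
    have -> : (U_(i) - U_(i) = 0)%MM by apply/mnmP => j; rewrite mnmBE subnn mnmE.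
    by rewrite mpolyX0 meval1 mul1r addr0 subrr.
  by move=> j /negPf ji; rewrite mxE mderivX mnm1E eq_sym ji scale0r meval0 mul0r.
- apply: mpow_eq (mpowD IHp IHq) => x _; rewrite !mevalD.
  have -> : grad1 (p + q) = grad1 p + grad1 q.
    by apply/rowP => j; rewrite !mxE mderivD mevalD.
  by rewrite linear_partD; ring.
(* With R for remainders and L for linear parts, the remainder of pq is q R_p + p(1) R_q + L_p (q -
   q(1)). *)
- pose dq x := q.@[coords x] - q.@[coords 1%g].
  have dq1 : mpow 1 dq.
    by apply: mpow_eq (mpowD (mpowS IHq) (linear_part_mpow (grad1 q))) => x _; rewrite subrK.
  have qreg : reg (fun x => q.@[coords x]) by exists q.
  have := mpowD (mpowD (mpowMl qreg IHp) (mpowZ p.@[coords 1%g] IHq))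
    (mpowM (linear_part_mpow (grad1 p)) dq1).
  apply: mpow_eq => x _; rewrite grad1M linear_partD !linear_partZ !mevalM /dq; ring.
Qed.

Lemma mpow1 f : reg f -> f 1%g = 0 -> mpow 1 f.
Proof.
move=> [p pE] f1; have p1 : p.@[coords 1%g] = 0 by rewrite -pE //; exact: idcomp1.
apply: mpow_eq (mpowD (mpowS (taylor p)) (linear_part_mpow (grad1 p))) => x Hx.
by rewrite subrK p1 subr0 pE.
Qed.

(* Derivations e_i with f = \sum_i e_i(f) t_i modulo squares for every f
   vanishing at 1: the t_i span the cotangent space of H, and the e_i come from
   a projection of k^n along the gradients of the equations of H. *)
Lemma dual_derivations : exists2 e : 'I_n -> (G -> k) -> k,
  forall i, derivation (e i) &
  forall f, reg f -> f 1%g = 0 -> mpow 2 (fun x => f x - \sum_i e i f * t i x).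
Proof.
pose I : set {mpoly k[n]} := [set p | forall x, H x -> p.@[coords x] = 0].
pose U : set 'rV[k]_n := [set grad1 p | p in I].
have gradD p q : grad1 (p + q) = grad1 p + grad1 q.
  by apply/rowP => j; rewrite !mxE mderivD mevalD.
have gradB p q : grad1 (p - q) = grad1 p - grad1 q.
  by apply/rowP => j; rewrite !mxE mderivB mevalB.
have [|||A AU] := @subspace_rowspace k n U.
- exists 0; first by move=> x _; rewrite meval0.
  by apply/rowP => j; rewrite !mxE mderiv0 meval0.
- move=> _ _ [p Ip <-] [q Iq <-]; exists (p + q); last by rewrite gradD.
  by move=> x Hx; rewrite mevalD Ip ?Iq ?addr0.
- move=> c _ [p Ip <-]; exists (c *: p).
    by move=> x Hx; rewrite mevalZ Ip ?mulr0.
  by apply/rowP => j; rewrite !mxE mderivZ mevalZ.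
(* [Pi] annihilates the gradients of equations of H, so [e] does not depend on the polynomial
   representing [f]. *)
pose Pi : 'M[k]_n := 1%:M - pinvmx A *m A.
have PiU c : U c -> c *m Pi = 0.
  by move/AU => cA; rewrite mulmxBr mulmx1 mulmxA mulmxKpV // subrr.
pose rep f := xget 0 [set p : {mpoly k[n]} | forall x, H x -> f x = p.@[coords x]].
pose e i f := (grad1 (rep f) *m Pi) 0 i.
have eE i f p : (forall x, H x -> f x = p.@[coords x]) -> e i f = (grad1 p *m Pi) 0 i.
  move=> fE; have repE : forall x, H x -> f x = (rep f).@[coords x].
    exact: (@xgetPex _ _ [set p : {mpoly k[n]} | forall x, H x -> f x = p.@[coords x]]
      (ex_intro _ p fE)).
  apply/eqP; rewrite -subr_eq0 /e; apply/eqP.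
  have -> : (grad1 (rep f) *m Pi) 0 i - (grad1 p *m Pi) 0 i =
      ((grad1 (rep f) - grad1 p) *m Pi) 0 i.
    by rewrite mulmxBl !mxE.
  rewrite -gradB PiU ?mxE //; exists (rep f - p) => // x Hx.
  by rewrite mevalB -repE // fE // subrr.
have H1 := idcomp1 G.
exists e.
  move=> i; split.
  - move=> f f' [p pE] ff'; rewrite (eE i f p pE); apply/esym/eE => x Hx.
    by rewrite -ff' ?pE.
  - move=> f f' [p pE] [q qE]; rewrite (eE i f p) // (eE i f' q) // (eE i _ (p + q)).
      by rewrite gradD mulmxDl mxE.
    by move=> x Hx; rewrite mevalD pE ?qE.
  - move=> f f' [p pE] [q qE]; rewrite (eE i f p) // (eE i f' q) // (eE i _ (p * q)).
      rewrite grad1M mulmxDl -!scalemxAl pE // qE // !mxE addrC.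
      by rewrite [q.@[_] * _]mulrC.
    by move=> x Hx; rewrite mevalM pE ?qE.
  - move=> c; rewrite (eE i _ c%:MP); last by move=> x _; rewrite mevalC.
    have -> : grad1 c%:MP = 0 by apply/rowP => j; rewrite !mxE mderivC meval0.
    by rewrite mul0mx mxE.
move=> f [p pE] f1.
(* The part of the gradient removed by [Pi] is the gradient of an equation [q] of H, whose Taylor
   expansion may be subtracted because [q] vanishes on H. *)
have [q Iq qE] : U (grad1 p *m pinvmx A *m A) by apply/AU; apply: submxMl.
apply: mpow_eq (mpowB (taylor p) (taylor q)) => x Hx.
rewrite Iq // Iq // -pE // -pE // f1 subrr sub0r opprK subr0 -addrA; congr (_ + _).
rewrite (eq_bigr (fun i => (grad1 p - grad1 q) 0 i * t i x)); last first.
  by move=> i _; rewrite (eE i f p) // qE /Pi mulmxBr mulmx1 mulmxA.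
rewrite -[X in - X]/(linear_part (grad1 p - grad1 q) x) -scaleN1r linear_partD linear_partZ; ring.
Qed.

(* Modulo the (j+1)-st power of the maximal ideal, the Euler operator
   E f = \sum_i t_i (e_i f) is multiplication by j on the j-th power; if all
   derivatives of f vanish, then E f = 0, and j is invertible. *)
Lemma derivations_vanish_mpow f : reg f ->
  (forall d x, derivation d -> H x -> d (fun y => f (x * y)%g) = 0) ->
  forall j, mpow j (fun x => f x - f 1%g).
Proof.
move=> freg df0; have [e eder eP] := dual_derivations.
pose D i f x := e i (fun y => f (x * y)%g).
have Dreg i f' : reg f' -> reg (D i f') by apply: regular_derivation.
pose E f x := \sum_i t i x * D i f x.
have E_eq f1 f2 x : reg f1 -> (forall y, H y -> f1 y = f2 y) -> H x -> E f1 x = E f2 x.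
  move=> f1reg f12 Hx; apply: eq_bigr => i _; congr (_ * _).
  case: (eder i) => deq _ _ _; apply: deq; first exact: regH_mull.
  by move=> y Hy; apply/f12/idcompM.
have ED f1 f2 x : reg f1 -> reg f2 -> H x -> E (fun y => f1 y + f2 y) x = E f1 x + E f2 x.
  move=> r1 r2 Hx; rewrite /E -big_split; apply: eq_bigr => i _.
  rewrite /= -mulrDr; congr (_ * _); case: (eder i) => _ dD _ _.
  by rewrite /D dD //; apply: regH_mull.
have EM f1 f2 x : reg f1 -> reg f2 -> H x ->
    E (fun y => f1 y * f2 y) x = f1 x * E f2 x + E f1 x * f2 x.
  move=> r1 r2 Hx; rewrite /E mulr_sumr mulr_suml -big_split; apply: eq_bigr => i _.
  case: (eder i) => _ _ dM _; rewrite /D dM; [|exact: regH_mull..].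
  by rewrite /= mulg1 mulrDr mulrCA -mulrA.
have EC c x : E (fun=> c) x = 0.
  by rewrite /E big1 // => i _; case: (eder i) => _ _ _ dC; rewrite /D dC mulr0.
have Ereg f' : reg f' -> reg (E f').
  by move=> f'reg; apply: regular_sum => i _; apply: regularM => //; apply: Dreg.
have Esum (F : 'I_n -> G -> k) x : (forall i, reg (F i)) -> H x ->
    E (fun y => \sum_i F i y) x = \sum_i E (F i) x.
  move=> Freg Hx; rewrite /E [RHS]exchange_big /=; apply: eq_bigr => l _.
  by rewrite -mulr_sumr -derivation_sum // => i; apply: regH_mull.
(* Modulo the maximal ideal [D l (t i)] is the constant e_l(t_i), and the sum of the e_l(t_i) t_l is
   t_i modulo squares. *)
have Et i : mpow 2 (fun x => E (t i) x - t i x).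
  have tE := eP (t i) (tcoord_reg i) (tcoord1 i).
  have : mpow 2 (fun x => \sum_l t l x * (D l (t i) x - D l (t i) 1%g)).
    apply: mpow_sum => l; apply: mpow_t; apply: mpow1; last exact: subrr.
    by apply: regularB; [apply: Dreg | apply: regularC].
  move=> /mpowB/(_ tE); apply: mpow_eq => x Hx.
  rewrite [X in _ = _ + X]opprB [RHS]addrA; apply: (congr1 (fun z => z - t i x)).
  rewrite -big_split /=; apply: eq_bigr => l _.
  have -> : D l (t i) 1%g = e l (t i).
    case: (eder l) => deq _ _ _; apply: deq; first exact/regH_mull/tcoord_reg/idcomp1.
    by move=> y _; rewrite mul1g.
  by rewrite mulrBr [e l _ * _]mulrC subrK.
(* By the Leibniz rule E(t_i g_i) = t_i E(g_i) + E(t_i) g_i, which is j t_i g_i + t_i g_i modulo the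
   next power. *)
have euler j f' : mpow j f' -> mpow j.+1 (fun x => E f' x - j%:R * f' x).
  elim: j f' => [|j IHj] f'.
    move=> f'reg; apply: (@mpow_eq _ (E f')) => [x _|]; first by rewrite mul0r subr0.
    by apply: mpow_sum => i; apply: mpow_t; apply: Dreg.
  move=> [g [gj f'E]].
  have greg i : reg (g i) by apply: mpow_reg (gj i).
  have := mpow_sum (index_enum 'I_n)
    (fun i => mpowD (mpow_t i (IHj _ (gj i))) (mpowM (Et i) (gj i))).
  apply: mpow_eq => x Hx.
  have sreg : reg (fun x => \sum_i t i x * g i x).
    by apply: regular_sum => i _; apply: regularM.
  have f'reg : reg f' by apply: regular_eq sreg.
  rewrite (E_eq _ _ x f'reg f'E Hx) f'E // Esum //; last first.
    by move=> i; apply: regularM.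
  rewrite mulr_sumr -sumrB; apply: eq_bigr => i _.
  by rewrite EM // -natr1; ring.
pose f0 x := f x - f 1%g.
have f0reg : reg f0 by apply: regularB => //; apply: regularC.
have Ef0 x : H x -> E f0 x = 0.
  move=> Hx; rewrite /E big1 // => i _; rewrite /D derivationB //.
  - by rewrite df0 // sub0r; case: (eder i) => _ _ _ ->; rewrite oppr0 mulr0.
  - exact: regH_mull.
  - exact: regularC.
elim=> [//|[|j] IHj]; first by apply: mpow1 => //; apply: subrr.
have j0 : j.+1%:R != 0 :> k by rewrite natf_eq0.
apply: mpow_eq (mpowZ (- j.+1%:R^-1) (euler _ _ IHj)) => x Hx.
by rewrite -/(f0 x) -[E _ _]/(E f0 x) Ef0 // sub0r mulrN mulNr opprK mulKf.
Qed.

(** Since f - f(1) lies in every power of the maximal ideal at 1, Krull's theorem applies; so f =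
    f(1) wherever a differs from 1, a neighbourhood of 1. *)
Lemma derivations_vanish_local f : reg f ->
  (forall d x, derivation d -> H x -> d (fun y => f (x * y)%g) = 0) ->
  exists a, [/\ reg a, a 1%g = 0 &
    forall x, H x -> f x - f 1%g = a x * (f x - f 1%g)].
Proof.
move=> freg df0; have f0j := derivations_vanish_mpow freg df0.
pose I : set {mpoly k[n]} := [set p | forall x, H x -> p.@[coords x] = 0].
pose T i : {mpoly k[n]} := 'X_i - (coords 1%g i)%:MP.
have TE i x : (T i).@[coords x] = t i x by rewrite mevalB mevalXU mevalC.
have [q qE] : reg (fun x => f x - f 1%g) by apply: (f0j 0%N).
have Iideal : ideal I.
  split=> [x _|p p' Ip Ip' x Hx|a p Ip x Hx]; first exact: meval0.
    by rewrite mevalD Ip ?Ip' ?addr0.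
  by rewrite mevalM Ip ?mulr0.
have [|b bE] := @krull_intersection _ n T I q (@hilbert_basis k n) Iideal.
  move=> Q Qi IQ [s TsQ].
  (* Expanding an element of a high power of the maximal ideal moves its factors t_i into the
     exponents [c]; once their total exceeds n s, some exponent is at least s and the product lies
     in [Q]. *)
  suff count j : forall g (c : 'I_n -> nat) p, mpow j g -> (n * s < \sum_i c i + j)%N ->
      (forall x, H x -> g x = p.@[coords x]) -> Q ((\prod_i T i ^+ c i) * p).
    have -> : q = (\prod_i T i ^+ 0) * q.
      by rewrite big1 ?mul1r // => i _; rewrite expr0.
    apply: (count (n * s).+1 _ (fun=> 0%N) q (f0j _)) => //.
    by rewrite leq_addl.
  case: (Qi) => _ QD QM; elim: j => [|j IHj] g c p.
    move=> _; rewrite addn0 => lt_c _.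
    have [i ci] : exists i, (s <= c i)%N.
      apply: contrapT => nci; move: lt_c; rewrite ltnNge => /negP; apply.
      rewrite -[in X in (_ <= X * _)%N](card_ord n) -sum_nat_const leq_sum // => i _.
      by apply: ltnW; rewrite ltnNge; apply/negP => sc; apply: nci; exists i.
    rewrite (bigD1 i) //= -(subnK ci) exprD.
    have comm (x y z u : {mpoly k[n]}) : x * y * z * u = (x * z * u) * y by ring.
    by rewrite comm; apply: QM.
  move=> [h [hj gE]] le_c pE.
  have [P PE] := choice (fun i => mpow_reg (hj i)).
  have -> : p = (p - \sum_i T i * P i) + \sum_i T i * P i by rewrite subrK.
  rewrite mulrDr; apply: QD.
    apply/QM/IQ => x Hx; rewrite mevalB -pE // gE //.
    rewrite (raddf_sum (meval (coords x))) -sumrB big1 //= => i _.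
    by rewrite mevalM TE -PE // subrr.
  rewrite mulr_sumr; apply: ideal_sum => // i _.
  have -> : (\prod_l T l ^+ c l) * (T i * P i) =
      (\prod_l T l ^+ (c l + (l == i))%N) * P i.
    rewrite mulrA; congr (_ * _).
    rewrite (bigD1 i) //= [RHS](bigD1 i) //= eqxx addn1 exprS mulrC mulrA.
    by congr (_ * _); apply: eq_bigr => l /negPf ->; rewrite addn0.
  apply: (IHj (h i) (fun l => (c l + (l == i))%N) (P i) (hj i)) => [|x Hx]; last exact: PE.
  rewrite big_split /= -addnA.
  have -> : (\sum_l (l == i) = 1)%N by rewrite (bigD1 i) //= eqxx big1 // => l /negPf ->.
  by rewrite add1n.
exists (fun x => \sum_i (b i).@[coords x] * t i x); split.
- by apply: regular_sum => i _; apply: regularM => //; exists (b i).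
- by rewrite big1 // => i _; rewrite tcoord1 mulr0.
- move=> x Hx; apply/eqP; rewrite -subr_eq0 qE //; apply/eqP.
  have := bE x Hx; rewrite mevalB mevalM (raddf_sum (meval (coords x))) /=.
  by under eq_bigr do rewrite mevalM TE.
Qed.

(** Translating the local statement to each h with f(h) = f(1) shows that the closed set where f =
    f(1) is also open in H: its complement is where all translates of 1 - a vanish. *)
Lemma derivations_vanish_constant f : reg f ->
  (forall d x, derivation d -> H x -> d (fun y => f (x * y)%g) = 0) ->
  forall x, H x -> f x = f 1%g.
Proof.
move=> freg df0.
have loc h : H h -> exists a, [/\ reg a, a 1%g = 0 &
    forall x, H x -> f (h * x)%g - f h = a x * (f (h * x)%g - f h)].
  move=> Hh; have [||a [areg a1 aE]] := @derivations_vanish_local (fun x => f (h * x)%g).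
  - exact: regH_mull.
  - move=> d x der Hx; have [deq _ _ _] := der; rewrite -(df0 d (h * x)%g der (idcompM Hh Hx)).
    apply: deq; first exact: (regH_mull Hx (regH_mull Hh freg)).
    by move=> y _; rewrite mulgA.
  - by exists a; split=> // x Hx; have := aE x Hx; rewrite mulg1.
pose J := {h : G | H h /\ f h = f 1%g}.
pose a (h : J) := projT1 (cid (loc (sval h) (svalP h).1)).
have aP (h : J) := projT2 (cid (loc (sval h) (svalP h).1)).
have reg1 : reg (fun x => f x - f 1%g) by apply: regularB => //; apply: regularC.
have reg2 (h : J) : reg (fun x => 1 - a h ((sval h)^-1 * x)%g).
  apply: regularB; first exact: regularC.
  by apply: regH_mull; [apply: idcompV; case: (svalP h) | case: (aP h)].
have := idcomp_connected (I := unit) (fun=> reg1) reg2 (fun=> subrr _).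
move=> conn x Hx; apply/eqP; rewrite -subr_eq0; apply/eqP; apply: conn Hx tt => {x} x Hx.
- have [->|fx] := eqVneq (f x) (f 1%g); first by left=> _; rewrite subrr.
  right=> h; have [_ _ /(_ ((sval h)^-1 * x)%g)] := aP h; have [Hh fh] := svalP h.
  rewrite mulVKg => /(_ (idcompM (idcompV Hh) Hx)).
  have fx0 : f x - f (sval h) != 0 by rewrite fh subr_eq0.
  rewrite -{1}[f x - _]mul1r => /(mulIf fx0) aE.
  by rewrite /a -aE subrr.
- move=> /(_ tt)/eqP; rewrite subr_eq0 => /eqP fx.
  pose hx : J := exist _ x (conj Hx fx); exists hx; have [_ ax _] := aP hx.
  by rewrite (_ : (sval hx)^-1 * x = 1)%g ?mulVg // /a ax subr0 oner_neq0.
Qed.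

End Derivations.

(** * The Lie algebra of the identity component *)

Section DerivedSeries.
Variable gT : groupType.
Implicit Types K : set gT.

Lemma derived_subgroup_group K : is_subgroup (derived_subgroup K).
Proof.
split=> [A [[]//]|x y Kx Ky A AK|x Kx A AK]; have [[_ AM AV] _] := AK.
  by apply: AM; [apply: Kx | apply: Ky].
by apply: AV; apply: Kx.
Qed.

Lemma derived_subgroup_sub K : is_subgroup K -> derived_subgroup K `<=` K.
Proof.
move=> Kgrp; have [K1 KM KV] := Kgrp; apply: smallest_sub => // _ [x Kx [y Ky <-]].
exact: (KM _ _ (KV _ Kx) (KM _ _ (KV _ Ky) (KM _ _ Kx Ky))).
Qed.

Lemma iter_derived_group K i : is_subgroup K -> is_subgroup (iter i (@derived_subgroup gT) K).
Proof. by case: i => //= i _; apply: derived_subgroup_group. Qed.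

Lemma iter_derived_le K i j : is_subgroup K -> (i <= j)%N ->
  iter j (@derived_subgroup gT) K `<=` iter i (@derived_subgroup gT) K.
Proof.
move=> Kgrp /subnK <-; elim: (j - i)%N => [|l IHl] //.
rewrite addSn /=; apply: subset_trans IHl; apply: derived_subgroup_sub.
exact: iter_derived_group.
Qed.

End DerivedSeries.

Section LieAlgebra.
Variables (k : closedFieldType) (pchar_k : [pchar k] =i pred0).
Variable G : affine_algebraic_group k.
Local Notation n := (ambient_dim G).
Local Notation H := (identity_component G).
Local Notation reg := (regular H).
Implicit Types (f : G -> k) (d : (G -> k) -> k).

Lemma derivation_eq d f f' : derivation d -> reg f -> (forall x, H x -> f x = f' x) ->
  d f = d f'.
Proof. by case=> deq _ _ _; apply: deq. Qed.

Lemma regH_comp (phi : G -> G) f :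
  (forall f, regular setT f -> regular setT (fun x => f (phi x))) ->
  (forall x, H x -> H (phi x)) -> reg f -> reg (fun x => f (phi x)).
Proof.
move=> phireg Hphi [p pE].
apply: (@regular_eq _ _ _ (fun x => p.@[coords (phi x)])) => [x Hx|].
  by rewrite pE //; apply: Hphi.
by apply: regularS (@subsetT _ H) _; apply: (phireg (fun x => p.@[coords x])); exists p.
Qed.

Lemma regH_inv f : reg f -> reg (fun x => f x^-1%g).
Proof. by apply: regH_comp => [f'|x]; [exact: regular_inv | exact: idcompV]. Qed.

Lemma regH_conj g f : reg f -> reg (fun x => f (g * x * g^-1)%g).
Proof.
apply: (@regH_comp (fun x => g * x * g^-1)%g) => [f' f'reg|x]; last exact: idcompJ.
exact: (regular_mull g (regular_mulr g^-1%g f'reg)).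
Qed.

Lemma derivation_conj g d : derivation d -> derivation (fun f => d (fun x => f (g * x * g^-1)%g)).
Proof.
move=> [deq dD dM dC]; split=> [f f' freg ff'|f f' freg f'reg|f f' freg f'reg|c].
- apply: deq; first exact: regH_conj.
  by move=> x Hx; apply/ff'/idcompJ.
- by rewrite dD //; apply: regH_conj.
- by rewrite dM ?mulg1 ?mulgV //; apply: regH_conj.
- exact: dC.
Qed.

Lemma derivation_linear c d d' : derivation d -> derivation d' ->
  derivation (fun f => c * d f + d' f).
Proof.
move=> [deq dD dM dC] [d'eq d'D d'M d'C].
split=> [f f' freg ff'|f f' freg f'reg|f f' freg f'reg|a].
- by rewrite (deq f f') // (d'eq f f').
- by rewrite dD // d'D // mulrDr addrACA.
- rewrite dM // d'M // mulrDr addrACA [c * (d f * _)]mulrA -mulrDl [c * (_ * d f')]mulrCA.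
  by rewrite -mulrDr.
- by rewrite dC d'C mulr0 addr0.
Qed.

(** The value at 1 of the commutator of the left-invariant vector fields of [d] and [d']. *)
Definition derivation_lie d d' f :=
  d (fun h => d' (fun x => f (h * x)%g)) - d' (fun h => d (fun x => f (h * x)%g)).

(** A composite of two derivations fails the Leibniz rule only by cross terms symmetric in [d] and
    [d'], which cancel in the commutator. *)
Lemma derivation_lieP d d' : derivation d -> derivation d' ->
  derivation (derivation_lie d d').
Proof.
move=> der der'; have [deq dD dM dC] := der; have [d'eq d'D d'M d'C] := der'.
have comp d1 d2 : derivation d1 -> derivation d2 -> forall f f',
    reg f -> (forall x, H x -> f x = f' x) ->
    d1 (fun h => d2 (fun x => f (h * x)%g)) = d1 (fun h => d2 (fun x => f' (h * x)%g)).
  move=> der1 der2 f f' freg ff'; apply: derivation_eq => //.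
    exact: (regular_derivation der2 freg).
  move=> h Hh; apply: derivation_eq => //; first exact: (regH_mull Hh freg).
  by move=> x Hx; apply/ff'/idcompM.
have at1 d1 f : derivation d1 -> reg f -> d1 (fun x => f (1 * x)%g) = d1 f.
  move=> der1 freg; apply: derivation_eq => // [|x _]; last by rewrite mul1g.
  exact: (regH_mull (idcomp1 G) freg).
have leib d1 d2 : derivation d1 -> derivation d2 -> forall f f', reg f -> reg f' ->
    d1 (fun h => d2 (fun x => f (h * x)%g * f' (h * x)%g)) =
    f 1%g * d1 (fun h => d2 (fun x => f' (h * x)%g)) + d1 f * d2 f' +
    d2 f * d1 f' + d1 (fun h => d2 (fun x => f (h * x)%g)) * f' 1%g.
  move=> der1 der2 f f' freg f'reg; have [eq1 D1 M1 _] := der1; have [_ _ M2 _] := der2.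
  have r1 := regular_derivation der2 freg; have r2 := regular_derivation der2 f'reg.
  rewrite (eq1 _ (fun h => f h * d2 (fun x => f' (h * x)%g) + d2 (fun x => f (h * x)%g) * f' h)).
  - have r3 := regularM freg r2; have r4 := regularM r1 f'reg.
    by rewrite D1 // !M1 // !at1 // addrA.
  - exact: (regular_derivation der2 (regularM freg f'reg)).
  - by move=> h Hh; rewrite M2 ?mulg1 //; exact: regH_mull.
have leib_sub (a b A A' B B' p q : k) :
    a * A' + p + q + A * b - (a * B' + q + p + B * b) = a * (A' - B') + (A - B) * b.
  by ring.
split=> [f f' freg ff'|f f' freg f'reg|f f' freg f'reg|c]; rewrite /derivation_lie.
- by rewrite (comp d d' der der' f f') // (comp d' d der' der f f').
- have add d1 d2 : derivation d1 -> derivation d2 ->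
      d1 (fun h => d2 (fun x => f (h * x)%g + f' (h * x)%g)) =
      d1 (fun h => d2 (fun x => f (h * x)%g)) + d1 (fun h => d2 (fun x => f' (h * x)%g)).
    move=> der1 der2; have [eq1 D1 _ _] := der1; have [_ D2 _ _] := der2.
    rewrite -D1; [|exact: (regular_derivation der2 freg)|exact: (regular_derivation der2 f'reg)].
    apply: eq1.
      exact: (regular_derivation der2 (regularD freg f'reg)).
    by move=> h Hh; rewrite D2 //; apply: regH_mull.
  by rewrite (add d d') // (add d' d) // opprD addrACA.
- rewrite (leib d d' der der' f f' freg f'reg) (leib d' d der' der f f' freg f'reg).
  exact: leib_sub.
- by rewrite (dC (d' (fun=> c))) (d'C (d (fun=> c))) subrr.
Qed.

(** Formed with functionals and not with matrices, so that its vanishing, found in one faithful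
    representation, applies to all others. *)
Fixpoint derivation_series s : set ((G -> k) -> k) :=
  if s is s'.+1 then
    [set derivation_lie d d' | d in derivation_series s' & d' in derivation_series s']
  else @derivation k G.

Lemma derivation_seriesP s d : derivation_series s d -> derivation d.
Proof.
by elim: s d => // s IHs d [d1 /IHs der1 [d2 /IHs der2 <-]]; apply: derivation_lieP.
Qed.

Definition dmx d p q (F : G -> 'M[k]_(p, q)) : 'M[k]_(p, q) :=
  \matrix_(i, j) d (fun x => F x i j).

Lemma dmx_eq d p q (F F' : G -> 'M[k]_(p, q)) : derivation d -> mxregular H F ->
  (forall x, H x -> F x = F' x) -> dmx d F = dmx d F'.
Proof.
move=> der Freg FF'; apply/matrixP => i j; rewrite !mxE.
by apply: derivation_eq => // x Hx; rewrite FF'.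
Qed.

Lemma dmxC d p q (A : 'M[k]_(p, q)) : derivation d -> dmx d (fun=> A) = 0.
Proof. by case=> _ _ _ dC; apply/matrixP => i j; rewrite !mxE dC. Qed.

Lemma dmxM d p q r (F : G -> 'M[k]_(p, q)) (F' : G -> 'M_(q, r)) : derivation d ->
  mxregular H F -> mxregular H F' ->
  dmx d (fun x => F x *m F' x) = F 1%g *m dmx d F' + dmx d F *m F' 1%g.
Proof.
move=> der Freg F'reg; have [deq _ dM _] := der; apply/matrixP => i j; rewrite !mxE.
rewrite (deq _ (fun x => \sum_l F x i l * F' x l j)).
- rewrite derivation_sum // => [|l]; last exact: regularM.
  by rewrite -big_split; apply: eq_bigr => l _; rewrite dM // !mxE.
- exact: (mxregularM Freg F'reg).
- by move=> x _; rewrite mxE.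
Qed.

(** Multiplicativity is asked on H only: the subspaces and quotients met later are stable under H,
    not necessarily under G. *)
Definition representation_idcomp N (rho : G -> 'M[k]_N) :=
  [/\ rho 1%g = 1, forall x y, H x -> H y -> rho (x * y)%g = rho x * rho y &
      mxregular H rho].

Lemma representation_restrict N (rho : G -> 'M[k]_N) :
  representation rho -> representation_idcomp rho.
Proof. by case=> rho1 rhoM rreg; split=> //; apply: mxregularS rreg. Qed.

Section Representation.
Variables (N : nat) (rho : G -> 'M[k]_N).
Hypothesis rep : representation_idcomp rho.

Lemma rhoVr x : H x -> rho x * rho x^-1%g = 1.
Proof. by case: rep => r1 rM _ Hx; rewrite -rM ?mulgV //; apply: idcompV. Qed.

Lemma rhoVl x : H x -> rho x^-1%g * rho x = 1.
Proof. by case: rep => r1 rM _ Hx; rewrite -rM ?mulVg //; apply: idcompV. Qed.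

Lemma dmx_mull d h : derivation d -> H h ->
  dmx d (fun x => rho (h * x)%g) = rho h * dmx d rho.
Proof.
move=> der Hh; have [r1 rM rreg] := rep.
rewrite (dmx_eq (F' := fun x => rho h *m rho x) der).
- by rewrite dmxM // ?dmxC ?mul0mx ?addr0 //; apply: mxregularC.
- by move=> i j; apply: regH_mull Hh (rreg i j).
- by move=> x Hx; rewrite rM.
Qed.

Lemma dmx_lie d d' : derivation d -> derivation d' ->
  dmx (derivation_lie d d') rho = lie (dmx d rho) (dmx d' rho).
Proof.
move=> der der'; have [r1 rM rreg] := rep.
have comp d1 d2 : derivation d1 -> derivation d2 -> forall i j,
    d1 (fun h => d2 (fun x => rho (h * x)%g i j)) = (dmx d1 rho * dmx d2 rho) i j.
  move=> der1 der2 i j.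
  have -> : dmx d1 rho * dmx d2 rho = dmx d1 (fun x => rho x *m dmx d2 rho).
    by rewrite dmxM // ?dmxC ?mulmx0 ?add0r //; apply: mxregularC.
  rewrite mxE; apply: derivation_eq => //.
    exact: (@regular_derivation _ _ d2 (fun x => rho x i j)).
  by move=> h Hh; have /matrixP/(_ i j) := dmx_mull der2 Hh; rewrite !mxE.
by apply/matrixP => i j; rewrite /lie !mxE /derivation_lie !comp // !mxE.
Qed.

Lemma dmx_conj d h : derivation d -> H h ->
  dmx (fun f => d (fun x => f (h * x * h^-1)%g)) rho = rho h * dmx d rho * rho h^-1%g.
Proof.
move=> der Hh; have [r1 rM rreg] := rep.
have HV := idcompV Hh.
have -> : rho h * dmx d rho * rho h^-1%g = dmx d (fun x => (rho h *m rho x) *m rho h^-1%g).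
  have C A := @mxregularC _ G H N N A.
  rewrite (dmxM der (mxregularM (C _) rreg) (C _)) (dmxM der (C _) rreg) !dmxC //.
  by rewrite mulmx0 add0r mul0mx addr0.
apply: (dmx_eq (F := fun x => rho (h * x * h^-1)%g)) => // [i j|x Hx].
  exact: (regH_conj h (rreg i j)).
by rewrite !rM //; apply: idcompM.
Qed.

Lemma iter_lie_brackets s : iter s (@lie_brackets _) [set dmx d rho | d in @derivation k G] =
  [set dmx d rho | d in derivation_series s].
Proof.
elim: s => //= s ->; apply/seteqP; split=> X.
  move=> [_ [d1 ds1 <-] [_ [d2 ds2 <-] <-]]; exists (derivation_lie d1 d2).
    by exists d1 => //; exists d2.
  exact: dmx_lie (derivation_seriesP ds1) (derivation_seriesP ds2).
move=> [_ [d1 ds1 [d2 ds2 <-]] <-]; exists (dmx d1 rho); first by exists d1.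
exists (dmx d2 rho); first by exists d2.
exact/esym/(dmx_lie (derivation_seriesP ds1) (derivation_seriesP ds2)).
Qed.

End Representation.

Lemma derivation_coords d f : derivation d ->
  (forall i, d (fun x : G => coords x i) = 0) -> reg f -> d f = 0.
Proof.
move=> der d0 [p pE]; have [deq dD dM dC] := der.
have rp (q : {mpoly k[n]}) : reg (fun x => q.@[coords x]) by exists q.
rewrite -(deq (fun x => p.@[coords x])) // => [|x Hx]; last by rewrite pE.
elim/mpoly_ring_ind: p {pE} => [c|i|p q IHp IHq|p q IHp IHq].
- by rewrite -(dC c); apply: deq => // x _; rewrite mevalC.
- by rewrite -(d0 i); apply: deq => // x _; rewrite mevalXU.
- rewrite (deq _ (fun x => p.@[coords x] + q.@[coords x])) // => [|x _]; last exact: mevalD.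
  by rewrite dD // IHp IHq addr0.
- rewrite (deq _ (fun x => p.@[coords x] * q.@[coords x])) // => [|x _]; last exact: mevalM.
  by rewrite dM // IHp IHq mulr0 mul0r addr0.
Qed.

Lemma periodic_lie_solvable g : (forall h, H h -> finite_order (g * h)%g) ->
  exists s, forall d f, derivation_series s d -> reg f -> d f = 0.
Proof.
move=> per; have [N [rho [u [w [rep coordsE]]]]] := linearization G.
have [m m_gt0 exp_m] := periodic_exponent pchar_k rep per.
have [r1 rM rregT] := rep; have repH := representation_restrict rep.
have [_ _ rreg] := repH.
pose a := rho g; have am : a ^+ m = 1 by rewrite -(exp_m 1%g) ?mulg1 //; apply: idcomp1.
pose L := [set dmx d rho | d in @derivation k G].
have mk0 : m%:R != 0 :> k by rewrite natf_eq0 // -lt0n.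
have L0 : L 0.
  exists (fun=> 0); last by apply/matrixP => i j; rewrite !mxE.
  by split=> // *; rewrite ?mulr0 ?mul0r ?addr0.
have Llin c x y : L x -> L y -> L (c *: x + y).
  move=> [d1 der1 <-] [d2 der2 <-]; exists (fun f => c * d1 f + d2 f).
    exact: derivation_linear.
  by apply/matrixP => i j; rewrite !mxE.
have LZ c x : L x -> L (c *: x) by move=> Lx; rewrite -[_ *: _]addr0; apply: Llin.
have LB x y : L x -> L y -> L (x - y).
  by move=> Lx Ly; rewrite addrC -scaleN1r; apply: Llin.
have L_lie x y : L x -> L y -> L (lie x y).
  move=> [d1 der1 <-] [d2 der2 <-]; exists (derivation_lie d1 d2).
    exact: derivation_lieP.
  exact: dmx_lie.
have LJ x : L x -> L (a * x * a ^+ m.-1).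
  move=> [d der <-].
  have -> : a ^+ m.-1 = rho g^-1%g.
    have aV : a * rho g^-1%g = 1 by rewrite -rM mulgV.
    by rewrite -[LHS]mulr1 -aV mulrA -exprSr prednK // am mul1r.
  exists (fun f => d (fun x => f (g * x * g^-1)%g)); first exact: derivation_conj.
  have -> : a * dmx d rho * rho g^-1%g = dmx d (fun x => (rho g *m rho x) *m rho g^-1%g).
    have C A := @mxregularC _ G H N N A.
    rewrite (dmxM der (mxregularM (C _) rreg) (C _)) (dmxM der (C _) rreg) !dmxC //.
    by rewrite mulmx0 add0r mul0mx addr0.
  apply: (dmx_eq (F := fun x => rho (g * x * g^-1)%g)) => // [i j|y Hy].
    exact: (regH_conj g (rreg i j)).
  by rewrite !rM.
have L_fixed x : L x -> a * x = x * a -> x = 0.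
  case=> d der <-; set X := dmx d rho => aX.
  have areg : mxregular H (fun x => a *m rho x).
    by apply: mxregularM => //; apply: mxregularC.
  have aXj j : X * a ^+ j = a ^+ j * X.
    elim: j => [|j IHj]; first by rewrite expr0 mul1r mulr1.
    by rewrite exprSr mulrA IHj -mulrA -aX mulrA.
  (* As [X] commutes with [a], the derivative at 1 of (a rho(x))^j is j a^j X; for j = m the
     function is constant on H, so m X = 0. *)
  have pow j : dmx d (fun x => (a *m rho x) ^+ j) = j%:R *: (a ^+ j * X).
    elim: j => [|j IHj]; first by rewrite scale0r; apply: dmxC.
    rewrite (dmx_eq (F' := fun x => (a *m rho x) *m (a *m rho x) ^+ j)) //.
    - rewrite dmxM // ?IHj; last exact: mxregularX.
      rewrite dmxM // ?dmxC // ?mul0mx ?addr0; last exact: mxregularC.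
      rewrite r1 mulmx1 -scalemxAr !mulmxE -[a * X * _]mulrA aXj !mulrA -exprS.
      by rewrite -[X in _ + X]scale1r -scalerDl -natr1.
    - exact: (@mxregularX _ _ _ _ _ j.+1 areg).
    - by move=> x0 _; rewrite exprS.
  have := pow m; rewrite (dmx_eq (F' := fun=> 1)) //.
  - rewrite dmxC // am mul1r => /esym/eqP.
    by rewrite scaler_eq0 (negPf mk0) => /eqP.
  - exact: mxregularX.
  - by move=> x0 Hx0; rewrite -(exp_m x0 Hx0) rM.
have [s sP] := fixed_point_free_solvable pchar_k m_gt0 am L0 LB LZ L_lie LJ L_fixed.
exists s => d f ds freg; have der := derivation_seriesP ds.
(* The coordinates are matrix coefficients of [rho], so a derivation that kills [rho] kills every
   regular function. *)
apply: derivation_coords => // i.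
have dr0 : dmx d rho = 0 by apply: sP; rewrite iter_lie_brackets //; exists d.
have -> : d (fun x : G => coords x i) = dmx d (fun x => (u *m rho x) *m w i) 0 0.
  by rewrite mxE; apply: derivation_eq => //; exact: regular_coord.
have ureg : mxregular H (fun=> u) by exact: mxregularC.
have wreg : mxregular H (fun=> w i) by exact: mxregularC.
rewrite (dmxM der (mxregularM ureg rreg) wreg) (dmxM der ureg rreg) !dmxC // dr0.
by rewrite !(mulmx0, mul0mx, addr0) mxE.
Qed.

End LieAlgebra.

(** * Solvability *)

Lemma restrict_stable (k : fieldType) N p (U : 'M[k]_(p, N)) (X : 'M[k]_N) :
  (U *m X <= U)%MS ->
  row_base U *m X = row_base U *m X *m pinvmx (row_base U) *m row_base U.
Proof. by move=> UX; rewrite mulmxKpV // eq_row_base (eqmxMr _ (eq_row_base U)). Qed.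

(** In a nonzero common stable subspace of least dimension, an eigenspace of any [X] in [S] is again
    stable by commutation, hence everything; so every nonzero vector there is a common
    eigenvector. *)
Lemma commuting_eigenvector (k : closedFieldType) N (S : set 'M[k]_N) : (0 < N)%N ->
  (forall X Y, S X -> S Y -> X *m Y = Y *m X) ->
  exists2 v : 'rV[k]_N, v != 0 & forall X, S X -> exists c, v *m X = c *: v.
Proof.
move=> N_gt0 comm.
pose P r := `[< exists U : 'M[k]_N, [/\ \rank U = r, (0 < r)%N &
  forall X, S X -> (U *m X <= U)%MS] >].
have P_ex : exists r, P r.
  exists N; apply/asboolP; exists 1%:M; split; rewrite ?mxrank1 // => X _.
  exact: submx1.
case: (ex_minnP P_ex) => r /asboolP[U [rU r_gt0 Ustable]] rmin.
have scal X : S X -> exists c, U *m X = c *: U.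
  move=> SX; pose A := row_base U *m X *m pinvmx (row_base U).
  have [c rootc] : exists c, root (char_poly A) c.
    apply/closed_rootP.
    by rewrite size_char_poly rU eqSS -lt0n.
  move: rootc; rewrite -eigenvalue_root_char => /eigenvalueP[v vA v0].
  pose w := v *m row_base U.
  have wX : w *m X = c *: w.
    by rewrite /w -mulmxA (restrict_stable (Ustable X SX)) -/A mulmxA vA scalemxAl.
  pose E := (U :&: eigenspace X c)%MS.
  have w0 : w != 0.
    by apply: contraNneq v0 => w0; apply/eqP/(row_free_inj (row_base_free U)); rewrite mul0mx.
  have wE : (w <= E)%MS.
    rewrite sub_capmx; apply/andP; split; last by apply/eigenspaceP.
    by rewrite -(eq_row_base U) submxMl.
  have PE : P (\rank E).
    apply/asboolP; exists E; split=> // [|Y SY].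
      rewrite lt0n mxrank_eq0; apply: contraNneq w0 => E0.
      by move: wE; rewrite E0 submx0.
    rewrite sub_capmx (submx_trans (submxMr _ (capmxSl _ _))) ?Ustable //=.
    have /eigenspaceP EX : (E <= eigenspace X c)%MS by apply: capmxSr.
    by apply/eigenspaceP; rewrite -mulmxA (comm Y X) // mulmxA EX scalemxAl.
  have := rmin _ PE; rewrite -rU => rUE.
  have /andP[_ UE] : (E == U)%MS.
    by rewrite -mxrank_leqif_eq ?capmxSl // eqn_leq rUE mxrankS ?capmxSl.
  by exists c; apply/eigenspaceP; apply: submx_trans UE (capmxSr _ _).
have /rowV0Pn[v vU v0] : U != 0 by rewrite -mxrank_eq0 rU -lt0n.
exists v => // X /scal[c UX]; exists c; have /submxP[D ->] := vU.
by rewrite -mulmxA UX scalemxAr.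
Qed.

Section Solvable.
Variables (k : closedFieldType) (pchar_k : [pchar k] =i pred0).
Variable G : affine_algebraic_group k.
Local Notation n := (ambient_dim G).
Local Notation H := (identity_component G).
Local Notation reg := (regular H).
Local Notation derivation := (@derivation k G).

Lemma idcomp_group : is_subgroup H.
Proof. by split; [exact: idcomp1 | exact: idcompM | exact: idcompV]. Qed.

Definition invariant N (rho : G -> 'M[k]_N) (U : 'M[k]_N) :=
  forall h, H h -> (U *m rho h <= U)%MS.

Definition irreducible N (rho : G -> 'M[k]_N) := (0 < N)%N /\
  forall U, invariant rho U -> U != 0 -> row_full U.

(* The weights of a commuting set of matrices normalized by H are fixed by H,
   since H is connected and the eigenvalues of each matrix are finite in number. *)
Lemma commuting_scalar N (rho : G -> 'M[k]_N) (S : set 'M[k]_N) :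
  representation_idcomp rho -> irreducible rho ->
  (forall h X, H h -> S X -> S (rho h * X * rho h^-1%g)) ->
  (forall X Y, S X -> S Y -> X *m Y = Y *m X) ->
  forall X, S X -> exists c, X = c%:M.
Proof.
move=> rep [N_gt0 irr] SJ comm.
have [v v0 veig] := commuting_eigenvector N_gt0 comm.
have [chi chiP] : exists chi : 'M[k]_N -> k, forall X, S X -> v *m X = chi X *: v.
  have ex X : exists c, S X -> v *m X = c *: v.
    have [SX|nSX] := pselect (S X); last by exists 0.
    by have [c] := veig X SX; exists c.
  by have [chi] := choice ex; exists chi.
have [r1 rM rreg] := rep.
pose W : set 'rV[k]_N := [set w | forall X, S X -> w *m X = chi X *: w].
have WH w h : H h -> W w -> W (w *m rho h).
  move=> Hh Ww X SX; have [->|/rV0Pn[j wj]] := eqVneq w 0.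
    by rewrite !mul0mx scaler0.
  (* [f x] is the eigenvalue of [X] on [w *m rho x], a root of the characteristic polynomial of [X];
     it is therefore constant, equal to [chi X]. Thus [W] is stable under H and irreducibility makes
     it the whole space. *)
  pose f x := (w *m (rho x * X * rho x^-1%g)) 0 j / w 0 j.
  have fE x : H x -> w *m (rho x * X * rho x^-1%g) = f x *: w.
    move=> Hx; have wE := Ww _ (SJ x X Hx SX).
    by rewrite /f wE mxE mulfK.
  have wX x : H x -> w *m rho x *m X = f x *: (w *m rho x).
    move=> Hx; rewrite scalemxAl -fE // -!mulmxE -!mulmxA.
    by rewrite [rho x^-1%g *m rho x](rhoVl rep Hx) mulmx1.
  have freg : reg f.
    have rVreg : mxregular H (fun x => rho x^-1%g).
      by move=> i l; apply: (regH_inv (rreg i l)).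
    apply: regularM; last exact: regularC.
    apply: (mxregularM (F := fun=> w) (F' := fun x => rho x *m X *m rho x^-1%g)).
      exact: mxregularC.
    by apply: mxregularM => //; apply: mxregularM => //; apply: mxregularC.
  have cX : char_poly X != 0 by apply: monic_neq0; apply: char_poly_monic.
  have root_f x : H x -> root (char_poly X) (f x).
    move=> Hx; rewrite -eigenvalue_root_char; apply/eigenvalueP.
    exists (w *m rho x); first exact: wX.
    apply: contraNneq wj => wx0; rewrite -[w]mulmx1 -[1%:M](rhoVr rep Hx) mulmxA wx0.
    by rewrite mul0mx mxE.
  rewrite wX // (finite_valued_constant freg cX root_f Hh) /f invg1 r1.
  by rewrite mul1r mulr1 (Ww X SX) mxE mulfK.
have [|||U UW] := @subspace_rowspace k N W.
- by move=> X _; rewrite mul0mx scaler0.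
- by move=> w w' Ww Ww' X SX; rewrite mulmxDl Ww ?Ww' ?scalerDr.
- by move=> c w Ww X SX; rewrite -scalemxAl Ww // !scalerA mulrC.
have Uinv : invariant rho U.
  move=> h Hh; apply/row_subP => i; rewrite row_mul; apply/UW/WH => //.
  by apply/UW; apply: row_sub.
have U0 : U != 0.
  by apply: contraNneq v0 => U0; have /UW := chiP; rewrite U0 submx0.
have /row_fullP[D DU] := irr U Uinv U0.
move=> X SX; exists (chi X); apply/row_matrixP => i.
rewrite -{1}[X]mul1mx row_mul; have /UW -> // : (row i 1%:M <= U)%MS.
  by rewrite -DU row_mul submxMl.
by rewrite -[(chi X)%:M]scalemx1 linearZ.
Qed.

Lemma solvable_scalar N (rho : G -> 'M[k]_N) s (S : set 'M[k]_N) :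
  representation_idcomp rho -> irreducible rho ->
  (forall h X, H h -> S X -> S (rho h * X * rho h^-1%g)) ->
  (forall X, iter s (@lie_brackets _) S X -> X = 0) ->
  forall X, S X -> exists c, X = c%:M.
Proof.
move=> rep irr; have N_gt0 := irr.1.
elim: s S => [|s IHs] S SJ S0.
  by move=> X /S0 ->; exists 0; rewrite -[0%:M]scalemx1 scale0r.
have bracket0 : forall X Y, S X -> S Y -> lie X Y = 0.
  move=> X Y SX SY; have [|||c cE] := IHs (lie_brackets S) _ _ (lie X Y).
  - move=> h _ Hh [A SA [B SB <-]].
    exists (rho h * A * rho h^-1%g); first exact: SJ.
    exists (rho h * B * rho h^-1%g); first exact: SJ.
    have conjM C D : rho h * C * rho h^-1%g * (rho h * D * rho h^-1%g) =
        rho h * (C * D) * rho h^-1%g.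
      by rewrite !mulrA -[_ * rho h^-1%g * rho h]mulrA (rhoVl rep Hh) mulr1.
    by rewrite /lie !conjM mulrBr mulrBl.
  - by move=> A; rewrite -iterSr; apply: S0.
  - by exists X => //; exists Y.
  have: \tr (lie X Y) = 0 by rewrite /lie raddfB /= -!mulmxE mxtrace_mulC subrr.
  rewrite cE mxtrace_scalar -mulr_natr => /eqP; rewrite mulf_eq0 natf_eq0 //.
  by rewrite [N == 0%N]gtn_eqF // orbF => /eqP ->; rewrite -[0%:M]scalemx1 scale0r.
apply: (commuting_scalar rep irr SJ) => X Y SX SY.
by apply/eqP; rewrite -subr_eq0; apply/eqP; apply: bracket0.
Qed.

(* If the differential of rho is scalar then h |-> rho h Y rho h^-1 has zero
   derivative, hence is constant. *)
Lemma scalar_differential_commutes N (rho : G -> 'M[k]_N) : representation_idcomp rho ->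
  (forall d, derivation d -> exists c, dmx d rho = c%:M) ->
  forall x (Y : 'M[k]_N), H x -> rho x *m Y = Y *m rho x.
Proof.
move=> rep scal x Y Hx; have [r1 rM rreg] := rep.
have rVreg : mxregular H (fun x => rho x^-1%g) by move=> i l; apply: (regH_inv (rreg i l)).
have rYreg : mxregular H (fun x => rho x *m Y) by apply: mxregularM => //; apply: mxregularC.
pose F x := rho x *m Y *m rho x^-1%g.
have Freg : mxregular H F by apply: mxregularM.
have inv1 : rho 1^-1%g = 1 by rewrite invg1 r1.
have dF0 d : derivation d -> dmx d F = 0.
  move=> der; have [c cE] := scal d der.
  have dV : dmx d (fun x => rho x^-1%g) = - c%:M.
    have: dmx d (fun x => rho x *m rho x^-1%g) = 0.
      rewrite (dmx_eq (F' := fun=> 1)) ?dmxC //; first exact: mxregularM.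
      by move=> y Hy; apply: rhoVr.
    rewrite dmxM // r1 inv1 mul1mx mulmx1 cE => /eqP.
    by rewrite addr_eq0 => /eqP.
  rewrite /F dmxM // dmxM //; last exact: mxregularC.
  rewrite dmxC // r1 inv1 dV cE mul1mx mulmx0 add0r mulmx1 mulmxN.
  by rewrite -scalar_mxC addNr.
have Fconst : F x = F 1%g.
  apply/matrixP => i j.
  apply: (derivations_vanish_constant pchar_k (f := fun x => F x i j)) => // d y der Hy.
  have HVy := idcompV Hy.
  (* Since F(yz) = rho(y) F(z) rho(y)^-1, the derivative at [y] is a conjugate of the one at 1. *)
  have : dmx d (fun z => rho y *m F z *m rho y^-1%g) = 0.
    rewrite dmxM // ?dmxC // ?mulmx0 ?add0r;
      [|exact: mxregularM (mxregularC _ _) _|exact: mxregularC].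
    by rewrite dmxM // ?dmxC // ?dF0 // ?mulmx0 ?mul0mx ?addr0 ?mul0mx //; apply: mxregularC.
  move=> /matrixP/(_ i j); rewrite [RHS]mxE mxE => <-; apply: derivation_eq => //.
    exact: (regH_mull Hy (Freg i j)).
  move=> z Hz; have HVz := idcompV Hz.
  by rewrite /F invgM !rM // -!mulmxE !mulmxA.
have := Fconst; rewrite /F r1 inv1 mul1mx mulmx1 => FY; rewrite -{2}FY.
by rewrite -[RHS]mulmxA [rho x^-1%g *m _](rhoVl rep Hx) mulmx1.
Qed.

(** The kernel of [rho] on H is a subgroup that contains the commutators of [K]. *)
Lemma derived_trivial N (rho : G -> 'M[k]_N) (K : set G) : representation_idcomp rho ->
  is_subgroup K -> K `<=` H ->
  (forall x y, K x -> K y -> rho x *m rho y = rho y *m rho x) ->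
  forall x, derived_subgroup K x -> rho x = 1.
Proof.
move=> rep [K1 KM KV] KH comm x; have [r1 rM rreg] := rep.
suff sub : derived_subgroup K `<=` [set x | H x /\ rho x = 1] by move/sub => -[].
apply: smallest_sub.
  split=> [|y z [Hy ry] [Hz rz]|y [Hy ry]]; first by split; [exact: idcomp1 |].
    by split; [exact: idcompM | rewrite rM // ry rz mulr1].
  split; first exact: idcompV.
  by rewrite -(rhoVl rep Hy) ry mulr1.
move=> _ [y Ky [z Kz <-]].
have Kc : K [~ y, z]%g := KM _ _ (KV _ Ky) (KM _ _ (KV _ Kz) (KM _ _ Ky Kz)).
split; first exact: KH.
have Hy := KH _ Ky; have Hz := KH _ Kz; have Hc := KH _ Kc.
have Hzy : H (z * y)%g by apply: idcompM.
have : rho (z * y)%g * rho [~ y, z]%g = rho (z * y)%g.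
  by rewrite -rM // -commgC !rM // -!mulmxE comm.
by move/(congr1 (fun A => rho (z * y)%g^-1%g * A)); rewrite mulrA rhoVl // mul1r.
Qed.

Variable s : nat.
Hypothesis lie_solvable : forall d f, derivation_series s d -> reg f -> d f = 0.

Lemma representation_solvable N (rho : G -> 'M[k]_N) : representation_idcomp rho ->
  exists i, forall x, iter i (@derived_subgroup G) H x -> rho x = 1.
Proof.
elim/ltn_ind: N rho => N IHN rho rep; have [r1 rM rreg] := rep.
have Hgrp := idcomp_group.
have [N0|N_gt0] := posnP N.
  by exists 0%N => x _; move: (rho x); rewrite N0 => A; rewrite [A]flatmx0 [RHS]flatmx0.
have [irr|/existsNP[U /not_implyP[Uinv /not_implyP[U0 Ufull]]]] :=
    pselect (forall U, invariant rho U -> U != 0 -> row_full U).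
  exists 1%N; apply: (derived_trivial rep Hgrp) => // x y Hx Hy.
  apply: scalar_differential_commutes => // d der.
  apply: (solvable_scalar (s := s) (S := [set dmx d rho | d in derivation]) rep) => //.
  - move=> h _ Hh [d' der' <-]; rewrite -dmx_conj //.
    by exists (fun f => d' (fun x => f (h * x * h^-1)%g)) => //; apply: derivation_conj.
  - move=> X; rewrite iter_lie_brackets // => -[d' d's <-].
    by apply/matrixP => i j; rewrite !mxE lie_solvable //.
  - by exists d.
have rU : (0 < \rank U < N)%N.
  by rewrite lt0n mxrank_eq0 U0 ltn_neqAle rank_leq_col andbT; apply/negP.
pose B := row_base U.
have [rA repA] : exists rA : G -> 'M[k]_(\rank U),
    representation_idcomp rA /\ forall x, H x -> B *m rho x = rA x *m B.
  have Binj A A' : A *m B = A' *m B -> A = A' :> 'M_(\rank U).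
    by move/(row_free_inj (row_base_free U)).
  pose rA x := B *m rho x *m pinvmx B; exists rA.
  have BE x : H x -> B *m rho x = rA x *m B.
    by move=> Hx; apply: restrict_stable; apply: Uinv.
  split; last exact: BE.
  split.
  - by apply: Binj; rewrite -BE ?r1 ?mulmx1 ?mul1mx //; apply: idcomp1.
  - move=> x y Hx Hy; apply: Binj; rewrite -BE; last exact: idcompM.
    by rewrite rM // -!mulmxE -[RHS]mulmxA -(BE y Hy) [RHS]mulmxA -(BE x Hx) mulmxA.
  - by do ![apply: mxregularM => //; try exact: mxregularC].
(* [K] is the projection onto the quotient by [U], and [D] a section of it. *)
have [K KU [D DK]] : exists2 K : 'M_(N, \rank (cokermx U)),
    forall v : 'M_N, (v *m K == 0) = (v <= U)%MS & exists D, D *m K = 1%:M.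
  exists (col_base (cokermx U)); last exact/row_fullP/col_base_full.
  move=> v; have cE : v *m cokermx U = v *m col_base (cokermx U) *m row_base (cokermx U).
    by rewrite -mulmxA mulmx_base.
  rewrite submxE cE; apply/eqP/eqP => [->|]; first by rewrite mul0mx.
  by rewrite -(mul0mx _ (row_base (cokermx U))) => /(row_free_inj (row_base_free _)).
have [rC [repC KC]] : exists rC : G -> 'M[k]_(\rank (cokermx U)),
    representation_idcomp rC /\ forall x, H x -> rho x *m K = K *m rC x.
  have Kinj A A' : K *m A = K *m A' -> A = A' :> 'M_(\rank (cokermx U)).
    by move/(congr1 (mulmx D)); rewrite !mulmxA DK !mul1mx.
  pose rC x := D *m rho x *m K; exists rC.
  have KE x : H x -> rho x *m K = K *m rC x.
    move=> Hx; rewrite /rC; apply/eqP; rewrite -subr_eq0 !mulmxA -mulmxBl KU.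
    rewrite -{1}[rho x]mul1mx -mulmxBl.
    apply: submx_trans (submxMr _ _) (Uinv x Hx).
    by rewrite -KU mulmxBl mul1mx -mulmxA DK mulmx1 subrr.
  split; last exact: KE.
  split.
  - by apply: Kinj; rewrite -KE ?r1 ?mulmx1 ?mul1mx //; apply: idcomp1.
  - move=> x y Hx Hy; apply: Kinj; rewrite -KE; last exact: idcompM.
    by rewrite rM // -!mulmxE [RHS]mulmxA -(KE x Hx) -mulmxA (KE y Hy) mulmxA.
  - by do ![apply: mxregularM => //; try exact: mxregularC].
have [i1 i1P] := IHN _ (andP rU).2 rA repA.1.
have [|i2 i2P] := IHN _ _ rC repC.
  by rewrite mxrank_coker -subn_gt0 subKn ?rank_leq_col //; case/andP: rU.
pose L := iter (i1 + i2)%N (@derived_subgroup G) H.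
have L1 : L `<=` iter i1 (@derived_subgroup G) H by apply: iter_derived_le => //; apply: leq_addr.
have L2 : L `<=` iter i2 (@derived_subgroup G) H by apply: iter_derived_le => //; apply: leq_addl.
have LH : L `<=` H by apply: (@iter_derived_le _ _ 0).
exists (i1 + i2).+1; apply: (derived_trivial rep) => //; first exact: iter_derived_group.
(* On [L] both the subspace and the quotient are acted on trivially, so [rho x - 1] maps everything
   into [U] and kills [U]. Such products vanish in both orders, hence the matrices commute and one
   more derived term is trivial. *)
have unip x y : L x -> L y -> (rho x - 1) *m (rho y - 1) = 0.
  move=> Lx Ly; have : (rho x - 1 <= U)%MS.
    by rewrite -KU mulmxBl mul1mx KC ?i2P ?mulmx1 ?subrr //; [apply: L2 | apply: LH].
  rewrite -(eq_row_base U) => /submxP[Z ->].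
  rewrite -mulmxA mulmxBr mulmx1 repA.2; last exact: LH.
  by rewrite i1P ?mul1mx ?subrr ?mulmx0 //; apply: L1.
move=> x y Lx Ly; have := unip x y Lx Ly; rewrite -(unip y x Ly Lx).
rewrite !mulmxBl !mulmxBr !mulmx1 !mul1mx !opprB addrACA [RHS]addrACA.
by rewrite [- rho y - _]addrC => /addIr/addIr.
Qed.

End Solvable.

Theorem theorem2 (k : closedFieldType) (pchar_k : ([pchar k]%R =i pred0))
    (G : affine_algebraic_group k) :
  (exists C : set G, is_component C /\ periodic C) ->
  is_solvable (identity_component G).
Proof.
case=> _ [[g ->] per].
have [s sP] := periodic_lie_solvable pchar_k (fun h Hh => per _ (component_coset g Hh)).
have [N [rho [u [w [rep coordsE]]]]] := linearization G.
have [i iP] := representation_solvable pchar_k sP (representation_restrict rep).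
exists i; apply/seteqP; split=> x /=; last first.
  by move=> ->; have [] := @iter_derived_group _ _ i (idcomp_group G).
(* The coordinates are matrix coefficients of [rho], which is therefore faithful. *)
move=> /iP rx; apply: coords_inj => j; rewrite !coordsE rx.
by case: rep => ->.
Qed.
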